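(* Let $G$ be a connected Lie group with Lie algebra $\mathfrak{g}$, let $\Gamma$ be a left-invariant second-order differential equation field on $TG$ with reduced vector field $\gamma$ on $\mathfrak{g}$, let $g$ be an invariant multiplier for $\Gamma$, and let $(k_{ij})$ be the corresponding multiplier matrix for $\gamma$, i.e. $k_{ij}$ is the restriction of $g(\hat E_i,\hat E_j)$ to $T_eG=\mathfrak{g}$. Let $b=(b_i)$, $\alpha=(\alpha_{ij})$ be the cocycles determined by $g$ on $TG$ and $\nu=(\nu_i)$, $\mu=(\mu_{ij})$ the cocycles determined by $(k_{ij})$ on $\mathfrak{g}$, as described in the context. Then the two pairs of cohomology classes are the same: $[b]=[\nu]$ in $H^1(\mathfrak{g})$ and $[\alpha]=[\mu]$ in $H^2(\mathfrak{g})$. In fact $b_i=\nu_i$, and, when the function $l$ on $\mathfrak g$ used to define $\mu$ is the restriction to $T_eG$ of the Lagrangian $L$ used to define $\alpha$, $\alpha_{ij}=\mu_{ij}+C^k_{ij}f_k(e)$, so that $\alpha$ and $\mu$ differ by a coboundary.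
   Context: All objects are smooth; summation convention is used. $\tau:TG\to G$ is the projection, $(q^i,\dot q^i)$ are coordinates on $TG$ induced by local coordinates $(q^i)$ on $G$. For a vector field $X=X^i(q)\,\partial/\partial q^i$ on $G$, the vertical lift is $X^{V}=X^i\,\partial/\partial\dot q^i$ and the complete lift is $X^{C}=X^i\,\partial/\partial q^i+\frac{\partial X^i}{\partial q^j}\dot q^j\,\partial/\partial\dot q^i$. A second-order differential equation field is a vector field on $TG$ of the form $\Gamma=\dot q^i\,\partial/\partial q^i+f^i(q,\dot q)\,\partial/\partial\dot q^i$. Left-invariance on $TG$ means invariance under $T\lambda_h$ for all $h\in G$, $\lambda_h$ being left multiplication. A Lagrangian $L$ on $TG$ is regular if $(\partial^2L/\partial\dot q^i\partial\dot q^j)$ is everywhere non-singular, and it is a Lagrangian for $\Gamma$ if $\Gamma(X^{V}(L))=X^{C}(L)$ for all vector fields $X$ on $G$. Fix a basis $\{E_i\}$ of $\mathfrak{g}=T_eG$, $e$ being the identity; $\hat E_i$ and $\tilde E_i$ are the left-invariant, respectively right-invariant, vector fields on $G$ with value $E_i$ at $e$; $[\hat E_i,\hat E_j]=C_{ij}^k\hat E_k$, $[\tilde E_i,\tilde E_j]=-C_{ij}^k\tilde E_k$. The functions $w^i$ on $TG$ are defined by $v=w^i(v)\hat E_i(\tau(v))$; on $T_eG=\mathfrak{g}$ they are linear coordinates. Write $\Gamma=w^i\hat E_i^{C}+\Gamma^i\hat E_i^{V}$ with $\Gamma^i$ left-invariant; $\gamma^i=\Gamma^i|_{T_eG}$ and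 the reduced vector field is $\gamma=\gamma^i\,\partial/\partial w^i$ on $\mathfrak{g}$. Invariant multiplier for $\Gamma$: a type $(0,2)$ tensor field $g=g_{ij}(q,\dot q)\,dq^i\otimes dq^j$ along $\tau$ (a smoothly varying bilinear form on $T_{\tau(v)}G$ for $v\in TG$) such that all functions $g(\hat E_i,\hat E_j)$ are left-invariant on $TG$ and the Helmholtz conditions hold in local coordinates: (1) $\det(g_{ij})\ne0$, $g_{ij}=g_{ji}$; (2) $\Gamma(g_{ij})+\frac12\frac{\partial f^k}{\partial\dot q^j}g_{ik}+\frac12\frac{\partial f^k}{\partial\dot q^i}g_{kj}=0$; (3) $g_{ik}P^k_j=g_{jk}P^k_i$, with $P^k_j=\Gamma\big(\frac{\partial f^k}{\partial\dot q^j}\big)-2\frac{\partial f^k}{\partial q^j}-\frac12\frac{\partial f^l}{\partial\dot q^j}\frac{\partial f^k}{\partial\dot q^l}$; (4) $\frac{\partial g_{ij}}{\partial\dot q^k}=\frac{\partial g_{ik}}{\partial\dot q^j}$. Multiplier matrix for $\gamma$: a matrix $(k_{ij})$ of functions on $\mathfrak{g}$ satisfying (1') $\det(k_{ij})\ne0$, $k_{ij}=k_{ji}$; (2') $\gamma^k\frac{\partial k_{ij}}{\partial w^k}-k_{kj}\lambda^k_i-k_{ik}\lambda^k_j=0$; (3') $k_{ij}\phi^i_k=k_{ik}\phi^i_j$; (4') $\frac{\partial k_{ij}}{\partial w^l}=\frac{\partial k_{lj}}{\partial w^i}$; where $$\lambda^k_i=-\tfrac12\Big(\frac{\partial\gamma^k}{\partial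 w^i}-w^jC^k_{ji}\Big),$$ $$\phi^l_j=\tfrac12\gamma^i\frac{\partial^2\gamma^l}{\partial w^i\partial w^j}+\tfrac12\gamma^iC^l_{ij}-\tfrac14\frac{\partial\gamma^i}{\partial w^j}\frac{\partial\gamma^l}{\partial w^i}-\tfrac34C^k_{ij}w^i\frac{\partial\gamma^l}{\partial w^k}+\tfrac14w^iC^l_{ik}\frac{\partial\gamma^k}{\partial w^j}-\tfrac14w^mw^nC^k_{mj}C^l_{nk}.$$ If $g$ is an invariant multiplier for $\Gamma$, then $k_{ij}=g(\hat E_i,\hat E_j)|_{T_eG}$ is a multiplier matrix for $\gamma$. Cohomology: $H^\ast(\mathfrak{g})$ is the Lie algebra cohomology of $\mathfrak g$ with values in $\mathbf{R}$. $(b_i)$ is a 1-cocycle if $b_kC^k_{ij}=0$; 1-coboundaries are zero. An alternating $(\alpha_{ij})$ is a 2-cocycle if $\alpha_{il}C^l_{jk}+\alpha_{jl}C^l_{ki}+\alpha_{kl}C^l_{ij}=0$ and a 2-coboundary if $\alpha_{ij}=\theta_kC^k_{ij}$ for some constants $\theta_k$. Cocycles determined by $g$: there is a regular Lagrangian $L$ on $TG$ for $\Gamma$ (not necessarily invariant) with $g(\hat E_i,\hat E_j)=\hat E_i^{V}\hat E_j^{V}(L)$. There are functions $f_i$ on $G$, determined up to additive constants, and constants $b_i$ with $\tilde E_i^{C}(L)=w^j\hat E_j(f_i)+b_i$, and $\alpha_{ij}=\tilde E_i(f_j)-\tilde E_j(f_i)+C_{ij}^lf_l$ is constant. Then $b=(b_i)$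 and $\alpha=(\alpha_{ij})$ are cocycles. Cocycles determined by $(k_{ij})$: there is a function $l$ on $\mathfrak{g}$ with $\frac{\partial^2l}{\partial w^i\partial w^j}=k_{ij}$, determined up to the addition of a term linear in the $w^k$ and a constant. There are constants $\mu_{ij}=-\mu_{ji}$ and $\nu_i$ with $\gamma\big(\frac{\partial l}{\partial w^i}\big)-C^j_{ki}w^k\frac{\partial l}{\partial w^j}=\mu_{ji}w^j+\nu_i$. Then $\nu=(\nu_i)$ and $\mu=(\mu_{ij})$ are cocycles; a different choice of $l$ leaves $\nu$ unchanged and changes $\mu$ by a coboundary. The restriction of $L$ to $T_eG=\mathfrak g$ is one such function $l$. *)

(* Defs.v *)
From HB Require Import structures.
From mathcomp Require Import all_boot all_order all_algebra.
From mathcomp Require Import all_classical all_reals all_analysis.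

Set Implicit Arguments.
Unset Strict Implicit.
Unset Printing Implicit Defensive.

Import Order.TTheory GRing.Theory Num.Theory.
Import numFieldNormedType.Exports.

Local Open Scope classical_set_scope.
Local Open Scope ring_scope.

Section Smoothness.
Context {R : realType}.

(* On an open subset U of a finite-dimensional space this is the usual class
   C^k.  Derivatives are the two-sided ones of the ambient space, so U has to
   be open; that is the case in all uses below. *)
Fixpoint Ck (V W : normedModType R) (U : set V) (k : nat) (f : V -> W) : Prop :=
  match k with
  | 0 => forall x, U x -> {for x, continuous f}
  | k'.+1 => (forall x, U x -> differentiable f x) /\
             (forall v : V, Ck U k' (fun x => 'D_v f x))
  end.

Definition smooth_on (V W : normedModType R) (U : set V) (f : V -> W) : Prop :=
  forall k, Ck U k f.

End Smoothness.

(* A homeomorphism [cmap] from the open set [cdom] of T onto the open set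
   [ccod] of R^n, with inverse [cinv]; the values of [cmap] and [cinv] outside
   these sets are irrelevant. *)
Record chart (R : realType) (n : nat) (T : topologicalType) := Chart {
  cdom : set T;
  ccod : set 'rV[R]_n;
  cmap : T -> 'rV[R]_n;
  cinv : 'rV[R]_n -> T;
  cdom_open : open cdom;
  ccod_open : open ccod;
  cmap_cod : forall p, cdom p -> ccod (cmap p);
  cinv_dom : forall q, ccod q -> cdom (cinv q);
  cmapK : forall p, cdom p -> cinv (cmap p) = p;
  cinvK : forall q, ccod q -> cmap (cinv q) = q;
  cmap_continuous : forall p, cdom p -> {for p, continuous cmap};
  cinv_continuous : forall q, ccod q -> {for q, continuous cinv}
}.

(* Lie groups of dimension n.  [atlas] is a smooth atlas, and [chart_at p] is
   the index of a chart around p, the preferred chart at p. *)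
HB.mixin Record isLieGroup (R : realType) (n : nat) G
    of Topological G & Group G := {
  chart_index : Type;
  atlas : chart_index -> chart R n G;
  chart_at : G -> chart_index;
  chart_at_dom : forall p : G, cdom (atlas (chart_at p)) p;
  atlas_smooth : forall i j : chart_index,
    smooth_on [set q | ccod (atlas i) q /\ cdom (atlas j) (cinv (atlas i) q)]
              (fun q => cmap (atlas j) (cinv (atlas i) q));
  lie_hausdorff : hausdorff_space G;
  lie_second_countable : @second_countable G;
  lie_mul_continuous : continuous (fun z : G * G => (z.1 * z.2)%g);
  lie_mul_smooth : forall i j k : chart_index,
    smooth_on
      [set z : 'rV[R]_n * 'rV[R]_n |
         [/\ ccod (atlas i) z.1, ccod (atlas j) z.2
           & cdom (atlas k) (cinv (atlas i) z.1 * cinv (atlas j) z.2)%g]]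
      (fun z : 'rV[R]_n * 'rV[R]_n =>
         cmap (atlas k) (cinv (atlas i) z.1 * cinv (atlas j) z.2)%g);
  lie_inv_continuous : continuous (fun x : G => (x^-1)%g);
  lie_inv_smooth : forall i j : chart_index,
    smooth_on
      [set q | ccod (atlas i) q /\ cdom (atlas j) ((cinv (atlas i) q)^-1)%g]
      (fun q => cmap (atlas j) ((cinv (atlas i) q)^-1)%g)
}.

#[short(type="lieGroupType")]
HB.structure Definition LieGroup (R : realType) (n : nat) :=
  { G of Topological G & Group G & isLieGroup R n G }.

Section Geometry.
Context {R : realType} {n : nat} {G : lieGroupType R n}.

Local Notation Rn := ('rV[R]_n).
Local Notation index := (@chart_index R n G).

Definition cdomain (i : index) : set G := cdom (atlas i).
Definition crange (i : index) : set Rn := ccod (atlas i).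
Definition coord_map (i : index) : G -> Rn := cmap (atlas i).
Definition coord_inv (i : index) : Rn -> G := cinv (atlas i).
Definition at_pt (p : G) : index := chart_at p.

Definition basis_vec (a : 'I_n) : Rn := delta_mx 0 a.

(* A tangent vector at p is given by its components in the preferred chart at
   p.  Thus each T_p G is R^n, the pair (p, x) stands for the vector at p with
   components x in the chart [at_pt p], and tau is the first projection. *)
Definition TG : Type := (G * Rn)%type.

(* The coordinates (q, qdot) on TG induced by the chart i, and the inverse. *)
Definition tcoord (i : index) (v : TG) : Rn * Rn :=
  (coord_map i v.1,
   'D_(v.2) (coord_map i \o coord_inv (at_pt v.1)) (coord_map (at_pt v.1) v.1)).

Definition tpoint (i : index) (z : Rn * Rn) : TG :=
  let p := coord_inv i z.1 in
  (p, 'D_(z.2) (coord_map (at_pt p) \o coord_inv i) z.1).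

Definition tcenter (v : TG) : Rn * Rn := tcoord (at_pt v.1) v.

Definition trange (i : index) : set (Rn * Rn) := [set z | crange i z.1].

Definition smooth_fun (f : G -> R) : Prop :=
  forall i, smooth_on (crange i) (f \o coord_inv i).

(* A vector field on G; X p has the components of X at p in [at_pt p]. *)
Definition vfield : Type := G -> Rn.

Definition vf_loc (X : vfield) (i : index) (q : Rn) : Rn :=
  (tcoord i (coord_inv i q, X (coord_inv i q))).2.

Definition smooth_vf (X : vfield) : Prop :=
  forall i, smooth_on (crange i) (vf_loc X i).

Definition vf_app (X : vfield) (f : G -> R) (p : G) : R :=
  'D_(X p) (f \o coord_inv (at_pt p)) (coord_map (at_pt p) p).

Definition bracket (X Y : vfield) : vfield := fun p =>
  'D_(X p) (vf_loc Y (at_pt p)) (coord_map (at_pt p) p)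
  - 'D_(Y p) (vf_loc X (at_pt p)) (coord_map (at_pt p) p).

Definition smooth_tfun (F : TG -> R) : Prop :=
  forall i, smooth_on (trange i) (F \o tpoint i).

(* A vector field on TG; Z v has the components of Z at v with respect to the
   coordinates (q, qdot) induced by the chart [at_pt v.1]. *)
Definition tvfield : Type := TG -> Rn * Rn.

Definition tvf_app (Z : tvfield) (F : TG -> R) (v : TG) : R :=
  'D_(Z v) (F \o tpoint (at_pt v.1)) (tcenter v).

Definition tvf_loc (Z : tvfield) (i : index) (z : Rn * Rn) : Rn * Rn :=
  let v := tpoint i z in
  'D_(Z v) (tcoord i \o tpoint (at_pt v.1)) (tcenter v).

Definition smooth_tvf (Z : tvfield) : Prop :=
  forall i, smooth_on (trange i) (tvf_loc Z i).

Definition vlift (X : vfield) : tvfield := fun v => (0, X v.1).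

Definition clift (X : vfield) : tvfield := fun v =>
  (X v.1, 'D_(v.2) (vf_loc X (at_pt v.1)) (coord_map (at_pt v.1) v.1)).

(* The tangent map Th : TG -> TG of h : G -> G. *)
Definition tmap (h : G -> G) (v : TG) : TG :=
  (h v.1,
   'D_(v.2) (coord_map (at_pt (h v.1)) \o h \o coord_inv (at_pt v.1))
            (coord_map (at_pt v.1) v.1)).

Definition ltrans (h : G) : G -> G := fun x => (h * x)%g.
Definition rtrans (h : G) : G -> G := fun x => (x * h)%g.

Definition left_invariant_fun (F : TG -> R) : Prop :=
  forall (h : G) (v : TG), F (tmap (ltrans h) v) = F v.

(* T(T lambda_h) maps Z v to the value of Z at T lambda_h (v). *)
Definition left_invariant_tvf (Z : tvfield) : Prop :=
  forall (h : G) (v : TG),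
    let v' := tmap (ltrans h) v in
    'D_(Z v) (tcoord (at_pt v'.1) \o tmap (ltrans h) \o tpoint (at_pt v.1))
             (tcenter v) = Z v'.

(* The left- and right-invariant vector fields with value x in T_e G at e. *)
Definition lvf (x : Rn) : vfield := fun p => (tmap (ltrans p) (1%g, x)).2.
Definition rvf (x : Rn) : vfield := fun p => (tmap (rtrans p) (1%g, x)).2.

Definition is_sode (Z : tvfield) : Prop :=
  smooth_tvf Z /\ forall i z, trange i z -> (tvf_loc Z i z).1 = z.2.

(* d/dq^a and d/dqdot^a of a function of the coordinates (q, qdot). *)
Definition dq (a : 'I_n) (F : Rn * Rn -> R) (z : Rn * Rn) : R :=
  'D_((basis_vec a, 0) : Rn * Rn) F z.
Definition dqdot (a : 'I_n) (F : Rn * Rn -> R) (z : Rn * Rn) : R :=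
  'D_((0, basis_vec a) : Rn * Rn) F z.

Definition regular_lagrangian (L : TG -> R) : Prop :=
  smooth_tfun L /\
  forall i z, trange i z ->
    (\matrix_(a < n, b < n) dqdot a (dqdot b (L \o tpoint i)) z) \in unitmx.

Definition lagrangian_for (Gam : tvfield) (L : TG -> R) : Prop :=
  forall X : vfield, smooth_vf X ->
    forall v, tvf_app Gam (tvf_app (vlift X) L) v = tvf_app (clift X) L v.

(* Type (0,2) tensor fields along tau: g v is the Gram matrix of the bilinear
   form on T_{tau v} G in the components of the preferred chart at tau v. *)
Definition tensor2 : Type := TG -> 'M[R]_n.

Definition tensor_app (g : tensor2) (v : TG) (x y : Rn) : R :=
  (x *m g v *m y^T) 0 0.

(* g_ab in the chart i: (tpoint i (z.1, basis_vec a)).2 is d/dq^a. *)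
Definition tensor_loc (g : tensor2) (i : index) (a b : 'I_n) (z : Rn * Rn) : R :=
  tensor_app g (tpoint i z)
    (tpoint i (z.1, basis_vec a)).2 (tpoint i (z.1, basis_vec b)).2.

Definition smooth_tensor (g : tensor2) : Prop :=
  forall i a b, smooth_on (trange i) (tensor_loc g i a b).

Definition helmholtz (Gam : tvfield) (g : tensor2) (i : index) : Prop :=
  let f (k : 'I_n) (z : Rn * Rn) : R := (tvf_loc Gam i z).2 0 k in
  let gl : 'I_n -> 'I_n -> Rn * Rn -> R := tensor_loc g i in
  let D (F : Rn * Rn -> R) (z : Rn * Rn) : R := 'D_(tvf_loc Gam i z) F z in
  let P (k j : 'I_n) (z : Rn * Rn) : R :=
    D (dqdot j (f k)) z - 2 * dq j (f k) z
    - 2^-1 * \sum_(l < n) dqdot j (f l) z * dqdot l (f k) z in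
  forall z, trange i z ->
  [/\ \det (\matrix_(a < n, b < n) gl a b z) != 0 /\
      (forall a b, gl a b z = gl b a z),
      (forall a b, D (gl a b) z
         + 2^-1 * (\sum_(k < n) dqdot b (f k) z * gl a k z)
         + 2^-1 * (\sum_(k < n) dqdot a (f k) z * gl k b z) = 0),
      (forall a b, \sum_(k < n) gl a k z * P k b z
                   = \sum_(k < n) gl b k z * P k a z)
    & (forall a b c, dqdot c (gl a b) z = dqdot b (gl a c) z)].

Section Frame.
Variables (E : n.-tuple Rn) (C : 'I_n -> 'I_n -> 'I_n -> R).

(* The fields hat E_i and tilde E_i. *)
Definition Ehat (i : 'I_n) : vfield := lvf (tnth E i).
Definition Etilde (i : 'I_n) : vfield := rvf (tnth E i).

Definition structure_constants : Prop :=
  forall (i j : 'I_n) (p : G),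
    bracket (Ehat i) (Ehat j) p = \sum_(k < n) C i j k *: Ehat k p.

(* v = sum_i w i v *: Ehat i (tau v) *)
Definition w (i : 'I_n) (v : TG) : R :=
  coord [tuple Ehat j v.1 | j < n] i v.2.

(* On T_e G the functions w^i are the linear coordinates of the basis E, so
   that d/dw^i is the derivative in the direction of E_i. *)
Definition wlin (i : 'I_n) (x : Rn) : R := coord E i x.
Definition dw (i : 'I_n) (l : Rn -> R) (x : Rn) : R := 'D_(tnth E i) l x.

(* The components gamma^i of the reduced vector field on T_e G. *)
Definition is_reduced (Gam : tvfield) (gamma : 'I_n -> Rn -> R) : Prop :=
  exists Gc : 'I_n -> TG -> R,
    [/\ forall i, left_invariant_fun (Gc i),
        forall v, Gam v = \sum_(i < n) (w i v *: clift (Ehat i) v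
                                        + Gc i v *: vlift (Ehat i) v)
      & forall i x, gamma i x = Gc i (1%g, x)].

Definition invariant_multiplier (Gam : tvfield) (g : tensor2) : Prop :=
  [/\ smooth_tensor g,
      forall i j, left_invariant_fun
        (fun v => tensor_app g v (Ehat i v.1) (Ehat j v.1))
    & forall i, helmholtz Gam g i].

(* k_ij = g (hat E_i, hat E_j) on T_e G. *)
Definition restricted_multiplier (g : tensor2) (i j : 'I_n) (x : Rn) : R :=
  tensor_app g (1%g, x) (Ehat i 1%g) (Ehat j 1%g).

Definition cocycle1 (b : 'I_n -> R) : Prop :=
  forall i j, \sum_(k < n) b k * C i j k = 0.

Definition cocycle2 (a : 'I_n -> 'I_n -> R) : Prop :=
  (forall i j, a i j = - a j i) /\
  forall i j k,
    \sum_(l < n) (a i l * C j k l + a j l * C k i l + a k l * C i j l) = 0.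

Definition coboundary2 (a : 'I_n -> 'I_n -> R) : Prop :=
  exists theta : 'I_n -> R, forall i j, a i j = \sum_(k < n) theta k * C i j k.

(* Equality of classes in H^1 (where coboundaries are zero) and in H^2. *)
Definition same_class1 (b b' : 'I_n -> R) : Prop :=
  [/\ cocycle1 b, cocycle1 b' & forall i, b i - b' i = 0].

Definition same_class2 (a a' : 'I_n -> 'I_n -> R) : Prop :=
  [/\ cocycle2 a, cocycle2 a' & coboundary2 (fun i j => a i j - a' i j)].

(* (b, alpha) are determined by the multiplier g on TG through the choice of
   the Lagrangian L and of the functions f_i. *)
Definition determined_on_TG (Gam : tvfield) (g : tensor2)
    (L : TG -> R) (f : 'I_n -> G -> R)
    (b : 'I_n -> R) (alpha : 'I_n -> 'I_n -> R) : Prop :=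
  [/\ regular_lagrangian L /\ lagrangian_for Gam L,
      forall i j v, tensor_app g v (Ehat i v.1) (Ehat j v.1)
        = tvf_app (vlift (Ehat i)) (tvf_app (vlift (Ehat j)) L) v,
      forall i, smooth_fun (f i),
      forall i v, tvf_app (clift (Etilde i)) L v
        = \sum_(j < n) w j v * vf_app (Ehat j) (f i) v.1 + b i
    & forall i j p, alpha i j
        = vf_app (Etilde i) (f j) p - vf_app (Etilde j) (f i) p
          + \sum_(l < n) C i j l * f l p].

(* (nu, mu) are determined by the matrix k on T_e G through the choice of the
   function l. *)
Definition determined_on_g (gamma : 'I_n -> Rn -> R)
    (k : 'I_n -> 'I_n -> Rn -> R) (l : Rn -> R)
    (nu : 'I_n -> R) (mu : 'I_n -> 'I_n -> R) : Prop :=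
  [/\ smooth_on [set: Rn] l,
      forall i j x, dw i (dw j l) x = k i j x,
      forall i j, mu i j = - mu j i
    & forall i x,
        \sum_(m < n) gamma m x * dw m (dw i l) x
        - \sum_(m < n) \sum_(j < n) C m i j * wlin m x * dw j l x
        = \sum_(j < n) mu j i * wlin j x + nu i].

End Frame.

End Geometry.

Arguments TG {R n} G.
Arguments vfield {R n} G.
Arguments tvfield {R n} G.
Arguments tensor2 {R n} G.

(* Main.v *)
(* Everything takes place at the identity e, in the preferred chart there.
   Evaluating the Euler-Lagrange equation Gamma (X^V L) = X^C L on T_e G for
   X = tilde E_i, and differentiating tilde E_j^C (L) = w^k hat E_k (f_j) + b_j
   along the fibre in the direction E_i, one can eliminate every derivative of L
   along G.  The mixed second derivatives of the multiplication at e, which are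
   the derivatives at e of the invariant fields, then only enter through the
   structure constants, and the restriction l_e of L to T_e G satisfies the
   equation defining (nu, mu) with nu = b and
   mu_ij = alpha_ij - C_ij^k f_k(e).  Any other l has the same second derivatives,
   so it differs from l_e by an affine function, which changes mu by a coboundary.
   The cocycle conditions come from the bracket relations of the tilde E_i: for b,
   applied to the function q |-> L(q, 0), and for alpha, applied to the f_i. *)
Require Import Defs.
From HB Require Import structures.
From mathcomp Require Import all_boot all_order all_algebra.
From mathcomp Require Import all_classical all_reals all_analysis.
From mathcomp Require Import ring.

Import Order.TTheory GRing.Theory Num.Theory.
Import numFieldNormedType.Exports.
Local Open Scope classical_set_scope.
Local Open Scope ring_scope.

Set Implicit Arguments.
Unset Strict Implicit.
Unset Printing Implicit Defensive.

(** Gamma is written with complete lifts of the left-invariant fields, whereas f_i and b_i describe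
    L along complete lifts of the right-invariant ones. The bridge is that w^i hat E_i^C and w^j
    tilde E_j^C coincide on T_e G. At (e, x) the field Gamma is therefore w^j tilde E_j^C + gamma^m
    hat E_m^V, and every base derivative of L that occurs is controlled by the equation for tilde
    E_j^C (L). What survives is L differentiated along the vectors D_{E_m} tilde E_i - D_{E_i} tilde
    E_m, that is, along brackets at e. The encoding of tangent vectors shapes the preliminaries.
    Components refer to the chart preferred at the base point, and this chart may jump from point to
    point, so fields and functions on TG are rewritten in one fixed chart before they are
    differentiated along G. Smoothness is stated through iterated directional derivatives, so the
    symmetry of mixed derivatives and the product rule for variable directions are derived from that
    form. *)

Section DirectionalDerivatives.
Context {R : realType}.
Implicit Types U V W : normedModType R.

(** * Directional derivatives and the mean value theorem along a segment *)

Lemma derive_comp U V W (f : U -> V) (g : V -> W) x v :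
  differentiable f x -> differentiable g (f x) ->
  'D_v (g \o f) x = 'D_('D_v f x) g (f x).
Proof.
move=> df dg; have dgf := differentiable_comp df dg.
by rewrite !deriveE // diff_comp.
Qed.

(** The difference quotients on the two sides are equal term by term, so nothing is asked of f, not
    even differentiability. This handles all restrictions to slices such as [q |-> (q, e_pt)]. *)
Lemma derive_comp_affine U V W (f : V -> W) (phi : U -> V) x v y :
  (forall t : R, phi (t *: v + x) = t *: y + phi x) ->
  'D_v (f \o phi) x = 'D_y f (phi x).
Proof. by move=> phiE; rewrite /derive /=; under eq_fun do rewrite phiE. Qed.

Lemma derive_dirD V W (f : V -> W) x u v :
  differentiable f x -> 'D_(u + v) f x = 'D_u f x + 'D_v f x.
Proof. by move=> df; rewrite !deriveE // linearD. Qed.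

Lemma derive_dirB V W (f : V -> W) x u v :
  differentiable f x -> 'D_(u - v) f x = 'D_u f x - 'D_v f x.
Proof. by move=> df; rewrite !deriveE // linearB. Qed.

Lemma derive_dirZ V W (f : V -> W) x a v :
  differentiable f x -> 'D_(a *: v) f x = a *: 'D_v f x.
Proof. by move=> df; rewrite !deriveE // linearZ. Qed.

Lemma derive_dir_sum V W (f : V -> W) x (I : Type) (r : seq I) (F : I -> V) :
  differentiable f x ->
  'D_(\sum_(i <- r) F i) f x = \sum_(i <- r) 'D_(F i) f x.
Proof. by move=> df; rewrite deriveE // linear_sum; under eq_bigr do rewrite -deriveE //. Qed.

Lemma near_eq_differentiable V W (f g : V -> W) x :
  (\near x, f x = g x) -> differentiable f x -> differentiable g x.
Proof.
move=> fg df; have fgx : f x = g x := nbhs_singleton fg.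
have dfc : continuous ('d f x) by exact: diff_continuous.
have gE : g \o shift x = cst (g x) + 'd f x +o_ 0 id.
  apply/eqaddoP => e e0; move: fg; rewrite (near_shift 0 x) subr0 => fg.
  have /diff_locally /eqaddoP /(_ e e0) := df.
  apply: filter_app; near=> h => /=.
  rewrite !fctE /= fgx; have -> // : f (h + x) = g (h + x) by near: h.
by apply/diff_locallyP; rewrite (diff_unique dfc gE).
Unshelve. all: by end_near. Qed.

Lemma is_derive_line V W (f : V -> W) x v (t : R) :
  differentiable f (x + t *: v) ->
  is_derive t 1 (fun s : R => f (x + s *: v)) ('D_v f (x + t *: v)).
Proof.
move=> df.
have phiE s : x + (s *: (1 : R) + t) *: v = s *: v + (x + t *: v).
  by rewrite scalerDl [s *: _]mulr1 addrCA.
split.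
  have := @diff_derivable _ _ _ f _ v df; rewrite /derivable /=.
  by under eq_fun do rewrite -phiE.
exact: (@derive_comp_affine R^o V W f (fun s => x + s *: v) t 1 v phiE).
Qed.

Lemma mean_value_line V (f : V -> R) x v (h : R) : 0 < h ->
  (forall t : R, 0 <= t <= h -> differentiable f (x + t *: v)) ->
  exists2 t, 0 <= t <= h & f (x + h *: v) - f x = h * 'D_v f (x + t *: v).
Proof.
move=> h0 df.
have dl (t : R) : 0 <= t <= h ->
    is_derive t 1 (fun s : R => f (x + s *: v)) ('D_v f (x + t *: v)).
  by move=> th; apply: is_derive_line; exact: df.
have [|t|t th Et] := @MVT_segment R (fun s => f (x + s *: v))
    (fun s => 'D_v f (x + s *: v)) 0 h (ltW h0).
- by move=> t; rewrite in_itv /= => /andP[t0 th]; apply: dl; rewrite !ltW.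
- apply: derivable_within_continuous => s; rewrite in_itv /= => sh.
  by have [] := dl s sh.
exists t; first by move: th; rewrite in_itv.
by move: Et; rewrite scale0r addr0 subr0 mulrC.
Qed.

End DirectionalDerivatives.

(** * Symmetry of mixed second derivatives *)

Section Symmetry.
Context {R : realType} {V : normedModType R}.

(** Two mean values: of [F] along u, then of ['D_u f] along v. The second difference is symmetric in
    u and v, which is what lets [derive_sym] compare the two mixed derivatives. *)
Lemma second_difference (f : V -> R) x u v (h : R) : 0 < h ->
  (forall s t : R, 0 <= s <= h -> 0 <= t <= h ->
     differentiable f (x + s *: u + t *: v) /\
     differentiable ('D_u f) (x + s *: u + t *: v)) ->
  exists s t : R, [/\ 0 <= s <= h, 0 <= t <= h &
    f (x + h *: u + h *: v) - f (x + h *: u) - (f (x + h *: v) - f x) =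
    h * (h * 'D_v ('D_u f) (x + s *: u + t *: v))].
Proof.
move=> h0 df; have hh : 0 <= h <= h by rewrite lexx ltW.
have h00 : 0 <= (0 : R) <= h by rewrite lexx ltW.
pose F y := f (y + h *: v) - f y.
have dF (s : R) : 0 <= s <= h ->
    differentiable (fun y => f (y + h *: v)) (x + s *: u) /\
    differentiable f (x + s *: u).
  move=> sh; split; last by have [+ _] := df s 0 sh h00; rewrite scale0r addr0.
  apply: differentiable_comp; first exact: differentiableD.
  by have [] := df s h sh hh.
have [s sh Es] := @mean_value_line R V F x u h h0
   (fun s sh => differentiableB (dF s sh).1 (dF s sh).2).
have [t th Et] := @mean_value_line R V ('D_u f) (x + s *: u) v h h0
   (fun t th => (df s t sh th).2).
exists s, t; split => //; rewrite -Et.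
have -> : f (x + h *: u + h *: v) - f (x + h *: u) - (f (x + h *: v) - f x)
   = F (x + h *: u) - F x by [].
rewrite Es; congr (_ * _).
have [d1 d2] := dF s sh.
rewrite [LHS]deriveB; try exact: diff_derivable.
apply: (congr1 (fun z => z - _)).
apply: (@derive_comp_affine R V V R f (fun y => y + h *: v)) => t0.
by rewrite -addrA.
Qed.

Lemma dist_half (p q r e : R) :
  `|p - r| < e / 2 -> `|q - r| < e / 2 -> `|p - q| <= e.
Proof.
move=> pr qr; rewrite (splitr e) -(subrKA r) (le_trans (ler_normD _ _))//.
by rewrite lerD// ltW// distrC.
Qed.

Lemma continuous2_ball (U : set V) (A B : V -> R) x e : open U -> U x ->
  {for x, continuous A} -> {for x, continuous B} -> 0 < e ->
  exists2 d : R, 0 < d & forall y, `|x - y| < d ->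
    [/\ U y, `|A x - A y| < e & `|B x - B y| < e].
Proof.
move=> oU Ux cA cB e0.
have H1 : \forall y \near x, U y by exact: open_nbhs_nbhs.
have /cvgrPdist_lt /(_ _ e0) H2 := cA.
have /cvgrPdist_lt /(_ _ e0) H3 := cB.
have /nbhs_ballP[d /= d0 dP] : \forall y \near x,
    [/\ U y, `|A x - A y| < e & `|B x - B y| < e].
  by apply: filterS3 H1 H2 H3 => y.
by exists d => // y; rewrite -ball_normE /= in dP; exact: dP.
Qed.

Lemma derive_sym (U : set V) (f : V -> R) x u v : open U -> U x ->
  Ck U 2 f -> 'D_u ('D_v f) x = 'D_v ('D_u f) x.
Proof.
move=> oU Ux [df Df].
have c1 : {for x, continuous ('D_u ('D_v f))} by have [_ /(_ u)] := Df v; apply.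
have c2 : {for x, continuous ('D_v ('D_u f))} by have [_ /(_ v)] := Df u; apply.
apply/eqP; rewrite -subr_eq0 -normr_le0; apply/ler_addgt0Pr => e e0.
have e2 : 0 < e / 2 by rewrite divr_gt0.
have [d d0 dP] := continuous2_ball oU Ux c1 c2 e2.
(* The summand 1 makes N positive even for u = v = 0 and gives the strict bound |u| + |v| < N; with
   h = d / N the whole parallelogram then stays within distance d of x. *)
pose N := `|u| + `|v| + 1; have N0 : 0 < N by rewrite ltr_wpDl ?addr_ge0.
pose h := d / N; have h0 : 0 < h by rewrite divr_gt0.
have inb (a b : V) (s t : R) : `|a| + `|b| < N -> 0 <= s <= h -> 0 <= t <= h ->
    `|x - (x + s *: a + t *: b)| < d.
  move=> ab /andP[s0 sh] /andP[t0 th].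
  rewrite -addrA opprD addrA subrr sub0r normrN.
  rewrite (le_lt_trans (ler_normD _ _))// !normrZ !ger0_norm//.
  rewrite (@le_lt_trans _ _ (h * (`|a| + `|b|)))//.
    by rewrite mulrDr lerD// ler_wpM2r.
  by rewrite /h mulrAC ltr_pdivrMr// ltr_pM2l.
have uvN : `|u| + `|v| < N by rewrite ltrDl.
have vuN : `|v| + `|u| < N by rewrite [ltLHS]addrC ltrDl.
have [|s [t [sh th E1]]] := @second_difference f x u v h h0.
  move=> s t sh th; have [Uy _ _] := dP _ (inb _ _ _ _ uvN sh th).
  by split; [exact: df|have [+ _] := Df u; apply].
have [|s' [t' [sh' th' E2]]] := @second_difference f x v u h h0.
  move=> s' t' sh' th'; have [Uy _ _] := dP _ (inb _ _ _ _ vuN sh' th').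
  by split; [exact: df|have [+ _] := Df v; apply].
(* Both sides, multiplied by h twice, are the same second difference of f. *)
have E : 'D_v ('D_u f) (x + s *: u + t *: v) =
         'D_u ('D_v f) (x + s' *: v + t' *: u).
  apply: (mulfI (lt0r_neq0 h0)); apply: (mulfI (lt0r_neq0 h0)).
  apply: etrans (esym E1) (etrans _ E2).
  rewrite [x + h *: v + _]addrAC; move: (f _) (f _) (f _) (f _) => a b c d'.
  by rewrite -!addrA !opprB; congr (_ + _); rewrite addrCA [RHS]addrCA [- b + _]addrC.
have [_ _ H1] := dP _ (inb _ _ _ _ uvN sh th).
have [_ H2 _] := dP _ (inb _ _ _ _ vuN sh' th').
rewrite add0r; rewrite E in H1; apply: dist_half H2 H1.
Qed.

End Symmetry.

(** * Calculus of [Ck] and [smooth_on]: locality, affine substitutions, continuous linear maps *)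

Section Smooth.
Context {R : realType}.
Implicit Types V W Z : normedModType R.

(* Equivalently, [c] is linear and continuous. *)
Definition linear_diff V W (c : V -> W) : Prop :=
  (forall x, differentiable c x) /\ forall x v, 'D_v c x = c v.

(** Vectors and functionals that together reconstruct every v; in this form the property passes to
    products, hence to the model space of TG. *)
Definition finite_dim V : Prop :=
  exists N (e : 'I_N -> V) (c : 'I_N -> V -> R),
    (forall i, linear_diff (c i)) /\ forall v, v = \sum_i c i v *: e i.

Lemma continuous_linear_diff V W (c : {linear V -> W}) :
  continuous c -> linear_diff c.
Proof.
move=> cc; have dc x : differentiable c x by exact: linear_differentiable.
by split=> // x v; rewrite deriveE // diff_lin.
Qed.

Lemma linear_diff_derive Z V W (f : Z -> V) (c : V -> W) x v :
  linear_diff c -> differentiable f x -> 'D_v (c \o f) x = c ('D_v f x).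
Proof. by move=> [dc Dc] df; rewrite (derive_comp v df (dc _)) Dc. Qed.

Lemma linear_diffB V W (c : V -> W) x y :
  linear_diff c -> c (x - y) = c x - c y.
Proof. by move=> [dc Dc]; rewrite -!(Dc 0) (derive_dirB _ _ (dc 0)). Qed.

Lemma linear_diff_sum V W (c : V -> W) (I : Type) (r : seq I) (a : I -> R) (F : I -> V) :
  linear_diff c -> c (\sum_(i <- r) a i *: F i) = \sum_(i <- r) a i *: c (F i).
Proof.
move=> [dc Dc]; rewrite -(Dc 0) (derive_dir_sum _ _ (dc 0)).
by apply: eq_bigr => i _; rewrite (derive_dirZ _ _ (dc 0)) Dc.
Qed.

Lemma finite_dim_rV n : finite_dim 'rV[R]_n.
Proof.
exists n, (fun i => delta_mx 0 i), (fun i (v : 'rV[R]_n) => v 0 i); split=> [i|v].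
  have dc x : differentiable (fun v : 'rV[R]_n => v 0 i : R) x.
    exact: differentiable_coord.
  split=> // x v; have := derive_id x v => /(congr1 (fun z : 'rV[R]_n => z 0 i)).
  by rewrite derive_mx ?mxE; [|exact: derivable_id].
by rewrite [LHS]row_sum_delta.
Qed.

Lemma finite_dim_scalar : finite_dim R^o.
Proof.
exists 1, (fun=> 1), (fun _ => id); split=> [_|v].
  by split=> [//|x v]; rewrite derive_id.
by rewrite big_ord1 [_ *: _]mulr1.
Qed.

Lemma linear_diff_fst V W : linear_diff (fst : V * W -> V).
Proof.
have dfst x : differentiable (fst : V * W -> V) x.
  by apply: linear_differentiable => y; exact: cvg_fst.
split=> // x v.
by rewrite (@derive_comp_affine R _ V V idfun fst x v v.1) ?derive_id.
Qed.

Lemma linear_diff_snd V W : linear_diff (snd : V * W -> W).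
Proof.
have dsnd x : differentiable (snd : V * W -> W) x.
  by apply: linear_differentiable => y; exact: cvg_snd.
split=> // x v.
by rewrite (@derive_comp_affine R _ W W idfun snd x v v.2) ?derive_id.
Qed.

Lemma linear_diff_comp Z V W (c : Z -> V) (d : V -> W) :
  linear_diff c -> linear_diff d -> linear_diff (d \o c).
Proof.
move=> [dc Dc] [dd Dd]; split=> [x|x v]; first exact: differentiable_comp.
by rewrite derive_comp // Dd Dc.
Qed.

Lemma finite_dim_prod V W : finite_dim V -> finite_dim W -> finite_dim (V * W)%type.
Proof.
move=> [N [e [c [lc ec]]]] [M [e' [c' [lc' ec']]]].
exists (N + M)%N.
exists (fun i => match fintype.split i with inl j => (e j, 0) | inr j => (0, e' j) end).
exists (fun i z => match fintype.split i with inl j => c j z.1 | inr j => c' j z.2 end).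
split=> [i|[v w]].
  case: (fintype.split i) => j.
    exact: linear_diff_comp (@linear_diff_fst V W) (lc j).
  exact: linear_diff_comp (@linear_diff_snd V W) (lc' j).
rewrite big_split_ord /=.
under eq_bigr => i _ do rewrite (unsplitK (inl _ i)).
under [X in _ + X]eq_bigr => i _ do rewrite (unsplitK (inr _ i)).
rewrite [LHS]surjective_pairing [RHS]surjective_pairing /=; congr pair.
  rewrite !(big_morph (fst : V * W -> V) (id1 := 0) (op1 := +%R)) //=.
  by rewrite -ec big1 ?addr0 // => i _; rewrite scaler0.
rewrite !(big_morph (snd : V * W -> W) (id1 := 0) (op1 := +%R)) //=.
by rewrite -ec' big1 ?add0r // => i _; rewrite scaler0.
Qed.

Lemma near_eq V (T : Type) (U : set V) (f g : V -> T) x : open U -> U x ->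
  (forall y, U y -> f y = g y) -> \near x, f x = g x.
Proof.
move=> oU Ux fg; have : \near x, U x by exact: open_nbhs_nbhs.
by apply: filterS.
Qed.

Lemma Ck_eq V W U k (f g : V -> W) : open U -> (forall x, U x -> f x = g x) ->
  Ck U k f -> Ck U k g.
Proof.
move=> oU; elim: k f g => [|k IH] f g fg.
  move=> cf x Ux; have fgx := near_eq oU Ux fg.
  apply: cvg_trans; last by rewrite -(fg x Ux); exact: cf.
  exact: near_eq_cvg.
move=> [df Df]; split=> [x Ux|v].
  by apply: near_eq_differentiable (df x Ux); exact: (near_eq oU Ux fg).
by apply: IH (Df v) => x Ux; apply: near_eq_derive; exact: (near_eq oU Ux fg).
Qed.

Lemma Ck_sub V W U U' k (f : V -> W) : U' `<=` U -> Ck U k f -> Ck U' k f.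
Proof.
move=> sub; elim: k f => [|k IH] f; first by move=> cf x Ux; exact: cf (sub _ Ux).
by move=> [df Df]; split=> [x /sub /df //|v]; exact: IH (Df v).
Qed.

(** A is the linear part of phi. A directional derivative of the composite is again a composite with
    phi, namely of ['D_(A v) f], so the induction on k closes without a product rule. *)
Lemma Ck_comp_affine Z V W (X : set V) k (f : V -> W) (phi A : Z -> V) :
  (forall x, differentiable phi x) ->
  (forall (t : R) x v, phi (t *: v + x) = t *: A v + phi x) ->
  Ck X k f -> Ck (phi @^-1` X) k (f \o phi).
Proof.
move=> dphi phiE; elim: k f => [|k IH] f.
  move=> cf x Xx; apply: continuous_comp; last exact: cf.
  exact: differentiable_continuous.
move=> [df Df]; split=> [x Xx|v].
  by apply: differentiable_comp => //; exact: df.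
have -> : (fun x => 'D_v (f \o phi) x) = 'D_(A v) f \o phi.
  by apply/funext => x; apply: derive_comp_affine => t.
exact: IH (Df _).
Qed.

Lemma Ck_linear_comp Z V W (X : set Z) k (f : Z -> V) (c : V -> W) :
  open X -> linear_diff c -> Ck X k f -> Ck X k (c \o f).
Proof.
move=> oX [dc Dc]; elim: k f => [|k IH] f.
  move=> cf x Xx; apply: continuous_comp; first exact: cf.
  exact: differentiable_continuous.
move=> [df Df]; split=> [x Xx|v].
  by apply: differentiable_comp => //; exact: df.
apply: Ck_eq oX _ (IH _ (Df v)) => x Xx /=.
by rewrite derive_comp // ?Dc //; exact: df.
Qed.

Lemma smooth_eq V W U (f g : V -> W) : open U -> (forall x, U x -> f x = g x) ->
  smooth_on U f -> smooth_on U g.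
Proof. by move=> oU fg sf k; apply: Ck_eq (sf k). Qed.

Lemma smooth_sub V W U U' (f : V -> W) :
  U' `<=` U -> smooth_on U f -> smooth_on U' f.
Proof. by move=> sub sf k; apply: Ck_sub (sf k). Qed.

Lemma smooth_comp_affine Z V W (X : set V) (f : V -> W) (phi A : Z -> V) :
  (forall x, differentiable phi x) ->
  (forall (t : R) x v, phi (t *: v + x) = t *: A v + phi x) ->
  smooth_on X f -> smooth_on (phi @^-1` X) (f \o phi).
Proof. by move=> dphi phiE sf k; apply: Ck_comp_affine (sf k). Qed.

Lemma smooth_linear_comp Z V W (X : set Z) (f : Z -> V) (c : V -> W) :
  open X -> linear_diff c -> smooth_on X f -> smooth_on X (c \o f).
Proof. by move=> oX lc sf k; apply: Ck_linear_comp (sf k). Qed.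

Lemma smooth_differentiable V W U (f : V -> W) x :
  smooth_on U f -> U x -> differentiable f x.
Proof. by move=> /(_ 1%N) [df _]; exact: df. Qed.

Lemma smooth_derive V W U (f : V -> W) v : smooth_on U f -> smooth_on U ('D_v f).
Proof. by move=> sf k; have [_] := sf k.+1; apply. Qed.

Lemma finite_dim_inj V x y : finite_dim V ->
  (forall c : V -> R, linear_diff c -> c x = c y) -> x = y.
Proof.
move=> [N [e [c [lc ec]]]] xy; rewrite (ec x) (ec y).
by apply: eq_bigr => i _; rewrite (xy _ (lc i)).
Qed.

(** [derive_sym] rests on the mean value theorem and is therefore scalar; continuous linear
    functionals separate the points of W and reduce the claim to it. *)
Lemma derive_comm V W U (f : V -> W) x u v : finite_dim W -> open U -> U x ->
  smooth_on U f -> 'D_u ('D_v f) x = 'D_v ('D_u f) x.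
Proof.
move=> fW oU Ux sf; apply: finite_dim_inj fW _ => c lc; have [dc Dc] := lc.
have cD a b : 'D_a ('D_b (c \o f)) x = c ('D_a ('D_b f) x).
  have -> : 'D_a ('D_b (c \o f)) x = 'D_a (c \o 'D_b f) x.
    apply: near_eq_derive; apply: near_eq oU Ux _ => y Uy.
    by rewrite derive_comp // ?Dc //; exact: smooth_differentiable sf Uy.
  rewrite derive_comp // ?Dc //.
  exact: smooth_differentiable (smooth_derive b sf) Ux.
rewrite -(cD u v) -(cD v u).
exact: (@derive_sym R V U (c \o f) x u v oU Ux (smooth_linear_comp oU lc sf _)).
Qed.

End Smooth.

(** * Differentiation along a field whose direction varies *)

Section Fields.
Context {R : realType} {V : normedModType R}.
Hypothesis fV : finite_dim V.

(** In coordinates, ['D_(B y) f y] is the sum of the products [p i * q i] of the components of B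
    with the derivatives of f along [e i]. Freezing the first factor at x gives the first term,
    freezing the second gives the other. *)
Lemma derive_along (U : set V) (f : V -> R) (B : V -> V) x :
  open U -> U x -> smooth_on U f -> differentiable B x ->
  differentiable (fun y => 'D_(B y) f y) x /\
  forall a, 'D_a (fun y => 'D_(B y) f y) x
            = 'D_a ('D_(B x) f) x + 'D_('D_a B x) f x.
Proof.
move=> oU Ux sf dB; have [N [e [c [lc ec]]]] := fV.
pose p i : V -> R := c i \o B.
pose q i : V -> R := 'D_(e i) f.
have dp i : differentiable (p i) x.
  by apply: differentiable_comp => //; have [] := lc i.
have dq i : differentiable (q i) x.
  exact: smooth_differentiable (smooth_derive (e i) sf) Ux.
have fE v y : U y -> 'D_v f y = \sum_(i < N) c i v * q i y.
  move=> Uy; have df := smooth_differentiable sf Uy.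
  rewrite [in LHS](ec v) derive_dir_sum //.
  by apply: eq_bigr => i _; rewrite derive_dirZ.
have nearE : \near x, (\sum_(i < N) p i * q i) x = 'D_(B x) f x.
  by apply: (near_eq oU Ux) => y Uy; rewrite fE // fct_sumE.
split.
  apply: near_eq_differentiable nearE _.
  by apply: differentiable_sum => i; exact: differentiableM.
move=> a.
rewrite -(near_eq_derive a nearE) derive_sum; last first.
  by move=> i; apply: diff_derivable; exact: differentiableM.
have -> : 'D_a ('D_(B x) f) x = \sum_(i < N) p i x * 'D_a (q i) x.
  have nE : \forall y \near x, (\sum_(i < N) (p i x \*: q i)) y = 'D_(B x) f y.
    by apply: (near_eq oU Ux) => y Uy; rewrite fE // fct_sumE.
  rewrite -(near_eq_derive a nE) derive_sum; last first.
    by move=> i; apply: derivableZ; apply: diff_derivable.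
  by apply: eq_bigr => i _; rewrite deriveZ //; apply: diff_derivable.
rewrite fE // -big_split; apply: eq_bigr => i _ /=.
rewrite deriveM; try exact: diff_derivable.
have [dc Dc] := lc i.
rewrite (derive_comp a dB (dc (B x))) Dc.
by apply: (congr1 (+%R _)); exact: mulrC.
Qed.

(** By [derive_along] each iterated derivative is a second derivative of f plus a first-order term;
    the second derivatives cancel by symmetry. *)
Lemma bracket_derive (U : set V) (f : V -> R) (A B : V -> V) x :
  open U -> U x -> smooth_on U f -> differentiable A x -> differentiable B x ->
  'D_(A x) (fun y => 'D_(B y) f y) x - 'D_(B x) (fun y => 'D_(A y) f y) x
  = 'D_('D_(A x) B x - 'D_(B x) A x) f x.
Proof.
move=> oU Ux sf dA dB.
have [_ ->] := derive_along oU Ux sf dB.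
have [_ ->] := derive_along oU Ux sf dA.
rewrite (@derive_dirB _ _ _ f _ _ _ (smooth_differentiable sf Ux)).
rewrite (@derive_comm R V R^o U f x (A x) (B x) (@finite_dim_scalar R) oU Ux sf).
by rewrite opprD addrACA subrr add0r.
Qed.

End Fields.

(** * Change of charts on G and on TG *)

Section Charts.
Context {R : realType} {n : nat} {G : lieGroupType R n}.
Local Notation Rn := 'rV[R]_n.
Local Notation index := (@chart_index R n G).
Implicit Types (i j k : index) (p : G) (q : Rn).

Definition transition i j : Rn -> Rn := coord_map j \o coord_inv i.

Lemma at_ptP p : cdomain (at_pt p) p.
Proof. exact: chart_at_dom. Qed.

Lemma crange_open i : open (crange i).
Proof. exact: ccod_open. Qed.

Lemma coord_mapK i p : cdomain i p -> coord_inv i (coord_map i p) = p.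
Proof. exact: cmapK. Qed.

Lemma coord_invK i q : crange i q -> coord_map i (coord_inv i q) = q.
Proof. exact: cinvK. Qed.

Lemma coord_map_range i p : cdomain i p -> crange i (coord_map i p).
Proof. exact: cmap_cod. Qed.

Lemma coord_inv_domain i q : crange i q -> cdomain i (coord_inv i q).
Proof. exact: cinv_dom. Qed.

Lemma near_crange i q : crange i q -> \forall y \near q, crange i y.
Proof. by move=> iq; apply: open_nbhs_nbhs; split=> //; exact: crange_open. Qed.

Lemma near_cdomain i p : cdomain i p -> \forall x \near p, cdomain i x.
Proof. by move=> ip; apply: open_nbhs_nbhs; split=> //; exact: cdom_open. Qed.

Lemma near_inv_cdomain i j q : crange i q -> cdomain j (coord_inv i q) ->
  \forall y \near q, cdomain j (coord_inv i y).
Proof.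
by move=> iq jq; have := cinv_continuous iq; apply; exact: near_cdomain.
Qed.

Definition overlap i j : set Rn :=
  [set q | crange i q /\ cdomain j (coord_inv i q)].

Lemma overlap_open i j : open (overlap i j).
Proof.
rewrite openE => q [iq jq]; rewrite /interior.
by apply: filterS2 (near_crange iq) (near_inv_cdomain iq jq) => y.
Qed.

Lemma transition_smooth i j : smooth_on (overlap i j) (transition i j).
Proof. exact: atlas_smooth. Qed.

Lemma overlap_map i j p : cdomain i p -> cdomain j p -> overlap i j (coord_map i p).
Proof. by move=> ip jp; split; [exact: coord_map_range|rewrite coord_mapK]. Qed.

Lemma transition_map i j p : cdomain i p ->
  transition i j (coord_map i p) = coord_map j p.
Proof. by move=> ip; rewrite /transition /= coord_mapK. Qed.

Lemma transition_differentiable i j p : cdomain i p -> cdomain j p ->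
  differentiable (transition i j) (coord_map i p).
Proof.
by move=> ip jp; apply: smooth_differentiable (@transition_smooth i j) _; exact: overlap_map.
Qed.

Lemma derive_transition_id i p y : cdomain i p ->
  'D_y (transition i i) (coord_map i p) = y.
Proof.
move=> ip; rewrite -[RHS](derive_id (coord_map i p) y).
apply: near_eq_derive; apply: filterS (near_crange (coord_map_range ip)) => z iz.
exact: coord_invK.
Qed.

Lemma near_chart_change (W : Type) (phi : G -> W) i j p :
  cdomain i p -> cdomain j p ->
  \forall q \near coord_map i p,
    ((phi \o coord_inv j) \o transition i j) q = (phi \o coord_inv i) q.
Proof.
move=> ip jp; have [ir jr] := overlap_map ip jp.
apply: filterS (near_inv_cdomain ir jr) => y jy.
by rewrite /= /transition /= coord_mapK.
Qed.

Lemma chart_change_derive (W : normedModType R) (phi : G -> W) i j p y :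
  cdomain i p -> cdomain j p ->
  differentiable (phi \o coord_inv j) (coord_map j p) ->
  'D_y (phi \o coord_inv i) (coord_map i p) =
  'D_('D_y (transition i j) (coord_map i p)) (phi \o coord_inv j) (coord_map j p).
Proof.
move=> ip jp dphi.
rewrite -(near_eq_derive y (near_chart_change phi ip jp)).
have dphi' : differentiable (phi \o coord_inv j) (transition i j (coord_map i p)).
  by rewrite transition_map.
rewrite (derive_comp y (transition_differentiable ip jp) dphi').
by rewrite transition_map.
Qed.

(** Continuity of phi is a separate hypothesis because [coord_map i] has arbitrary values off its
    domain: differentiability of [coord_map i \o phi] does not by itself keep phi inside the domain
    near x. *)
Lemma curve_chart_change (V : normedModType R) (phi : V -> G) i j x v :
  {for x, continuous phi} -> cdomain i (phi x) -> cdomain j (phi x) ->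
  differentiable (coord_map i \o phi) x ->
  'D_v (coord_map j \o phi) x =
  'D_('D_v (coord_map i \o phi) x) (transition i j) (coord_map i (phi x)).
Proof.
move=> cphi ip jp dphi.
rewrite -(derive_comp v dphi (transition_differentiable ip jp)).
have nd : \forall y \near x, cdomain i (phi y) by apply: cphi; exact: near_cdomain.
apply: near_eq_derive; apply: filterS nd => y iy.
by rewrite /transition /= coord_mapK.
Qed.

Lemma transition_cocycle i j k p y : cdomain i p -> cdomain j p -> cdomain k p ->
  'D_('D_y (transition i j) (coord_map i p)) (transition j k) (coord_map j p)
  = 'D_y (transition i k) (coord_map i p).
Proof.
move=> ip jp kp; symmetry.
exact: (chart_change_derive y ip jp (transition_differentiable jp kp)).
Qed.

Lemma vf_locE (X : vfield G) i p : cdomain i p ->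
  vf_loc X i (coord_map i p) =
  'D_(X p) (transition (at_pt p) i) (coord_map (at_pt p) p).
Proof. by move=> ip; rewrite /vf_loc /tcoord /= coord_mapK. Qed.

Lemma vf_app_loc (X : vfield G) (phi : G -> R) i p : cdomain i p ->
  differentiable (phi \o coord_inv i) (coord_map i p) ->
  vf_app X phi p =
  'D_(vf_loc X i (coord_map i p)) (phi \o coord_inv i) (coord_map i p).
Proof.
move=> ip dphi; rewrite vf_locE // /vf_app.
exact: (chart_change_derive (X p) (at_ptP p) ip dphi).
Qed.

Lemma tpoint_map i p y : cdomain i p ->
  tpoint i (coord_map i p, y) =
  (p, 'D_y (transition i (at_pt p)) (coord_map i p)).
Proof. by move=> ip; rewrite /tpoint /= coord_mapK. Qed.

Lemma tpoint_change i j p y : cdomain i p -> cdomain j p ->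
  tpoint i (coord_map i p, y) =
  tpoint j (coord_map j p, 'D_y (transition i j) (coord_map i p)).
Proof.
move=> ip jp; rewrite (tpoint_map _ ip) (tpoint_map _ jp).
by rewrite (transition_cocycle y ip jp (at_ptP p)).
Qed.

Lemma tcenterE p (x : Rn) : tcenter (p, x) = (coord_map (at_pt p) p, x).
Proof. by rewrite /tcenter /tcoord /= derive_transition_id //; exact: at_ptP. Qed.

Lemma derive_eq_line (V V' W : normedModType R) (f : V -> W) (g : V' -> W) x x' v v' :
  (forall t : R, f (t *: v + x) = g (t *: v' + x')) -> 'D_v f x = 'D_v' g x'.
Proof.
move=> fg; have := fg 0; rewrite !scale0r !add0r => fg0.
by rewrite /derive /= fg0; under eq_fun do rewrite fg.
Qed.

(** A vertical line stays in one fibre, where the change of chart is linear. The two coordinate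
    expressions of L thus agree along the whole line, and no regularity of L is involved; so the
    formula also applies when L is itself a vertical derivative. *)
Lemma vlift_loc (X : vfield G) (L : TG G -> R) i p y : cdomain i p ->
  tvf_app (vlift X) L (tpoint i (coord_map i p, y)) =
  'D_((0, vf_loc X i (coord_map i p)) : Rn * Rn) (L \o tpoint i)
     (coord_map i p, y).
Proof.
move=> ip; have cp := at_ptP p; rewrite (tpoint_map y ip) /tvf_app tcenterE /=.
set c := at_pt p; set y' := 'D_y _ _.
have yE : 'D_y' (transition c i) (coord_map c p) = y.
  by rewrite (transition_cocycle y ip cp ip) (derive_transition_id y ip).
rewrite (vf_locE X ip) -/c.
apply: (@derive_eq_line (Rn * Rn)%type (Rn * Rn)%type R (L \o tpoint c) (L \o tpoint i)) => t /=.
have -> : t *: ((0, X p) : Rn * Rn) + (coord_map c p, y')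
  = (coord_map c p, t *: X p + y').
  by congr pair; rewrite /= ?scaler0 ?add0r.
rewrite (tpoint_change _ cp ip) derive_dirD; last exact: transition_differentiable.
rewrite derive_dirZ ?yE; last exact: transition_differentiable.
by congr (L (tpoint i _)); congr pair; rewrite /= ?scaler0 ?add0r.
Qed.

End Charts.

(** * Invariant fields as partial derivatives of the multiplication *)

Section Multiplication.
Context {R : realType} {n : nat} {G : lieGroupType R n}.
Local Notation Rn := 'rV[R]_n.
Local Notation index := (@chart_index R n G).
Implicit Types (i j k : index) (p : G) (q x y : Rn).

Definition mul_loc i j k (z : Rn * Rn) : Rn :=
  coord_map k (coord_inv i z.1 * coord_inv j z.2)%g.

Definition mul_dom i j k : set (Rn * Rn) :=
  [set z | [/\ crange i z.1, crange j z.2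
             & cdomain k (coord_inv i z.1 * coord_inv j z.2)%g]].

Lemma mul_loc_smooth i j k : smooth_on (mul_dom i j k) (mul_loc i j k).
Proof. exact: lie_mul_smooth. Qed.

Lemma mul_dom_map i j k p p' : cdomain i p -> cdomain j p' ->
  cdomain k (p * p')%g -> mul_dom i j k (coord_map i p, coord_map j p').
Proof.
by move=> ip jp kp; split => /=; rewrite ?coord_mapK //; exact: coord_map_range.
Qed.

Lemma mul_inv_continuous i j (z : Rn * Rn) : crange i z.1 -> crange j z.2 ->
  {for z, continuous (fun z : Rn * Rn => coord_inv i z.1 * coord_inv j z.2)%g}.
Proof.
move=> iz jz.
have c1 : {for z, continuous (coord_inv i \o (fst : Rn * Rn -> Rn))}.
  by apply: continuous_comp; [exact: cvg_fst|exact: (cinv_continuous iz)].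
have c2 : {for z, continuous (coord_inv j \o (snd : Rn * Rn -> Rn))}.
  by apply: continuous_comp; [exact: cvg_snd|exact: (cinv_continuous jz)].
apply: (@continuous_comp _ _ _
  (fun z : Rn * Rn => (coord_inv i z.1, coord_inv j z.2))
  (fun w : G * G => w.1 * w.2)%g z); last exact: lie_mul_continuous.
exact: (cvg_pair c1 c2).
Qed.

Lemma mul_dom_open i j k : open (mul_dom i j k).
Proof.
rewrite openE => z [iz jz kz]; rewrite /interior.
have n1 : \forall z' \near z, crange i z'.1.
  by have := @cvg_fst Rn Rn (nbhs z.1) (nbhs z.2) _; apply; exact: near_crange.
have n2 : \forall z' \near z, crange j z'.2.
  by have := @cvg_snd Rn Rn (nbhs z.1) (nbhs z.2) _; apply; exact: near_crange.
have cm := @mul_inv_continuous i j z iz jz.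
have n3 : \forall z' \near z, cdomain k (coord_inv i z'.1 * coord_inv j z'.2)%g.
  by apply: cm; exact: near_cdomain.
by apply: filterS3 n1 n2 n3 => z'.
Qed.

Definition e_chart : index := at_pt 1%g.
Definition e_pt : Rn := coord_map e_chart 1%g.

Lemma e_chartP : cdomain e_chart 1%g.
Proof. exact: at_ptP. Qed.

Lemma e_ptP : crange e_chart e_pt.
Proof. exact: coord_map_range e_chartP. Qed.

Lemma mul_e_left i p : cdomain i p -> mul_dom e_chart i i (e_pt, coord_map i p).
Proof. by move=> ip; apply: mul_dom_map => //; [exact: e_chartP|rewrite mul1g]. Qed.

Lemma mul_e_right i p : cdomain i p -> mul_dom i e_chart i (coord_map i p, e_pt).
Proof. by move=> ip; apply: mul_dom_map => //; [exact: e_chartP|rewrite mulg1]. Qed.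

Lemma differentiable_left q x : differentiable (fun y : Rn => (y, q)) x.
Proof. exact: differentiable_pair. Qed.

Lemma differentiable_right q x : differentiable (fun y : Rn => (q, y)) x.
Proof. exact: differentiable_pair. Qed.

(** The value at p is the velocity of [u |-> p * u] at u = e, recorded in the preferred chart of p;
    [curve_chart_change] moves it to the chart i. As a partial derivative of one smooth map, the
    field can be differentiated in p. *)
Lemma vf_loc_lvf x i p : cdomain i p ->
  vf_loc (lvf x) i (coord_map i p)
  = 'D_((0, x) : Rn * Rn) (mul_loc i e_chart i) (coord_map i p, e_pt).
Proof.
move=> ip; rewrite (vf_locE _ ip) /lvf /tmap /ltrans /= mulg1.
rewrite -/e_chart -/e_pt.
set c := at_pt p.
pose phi : Rn -> G := fun u => (p * coord_inv e_chart u)%g.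
have phi1 : phi e_pt = p by rewrite /phi coord_mapK ?mulg1 //; exact: e_chartP.
have cp : cdomain c p := at_ptP p.
have E (k : index) : coord_map k \o phi = mul_loc i e_chart k \o (fun u => (coord_map i p, u)).
  by apply/funext => u; rewrite /mul_loc /= coord_mapK.
have dphi (k : index) : cdomain k p -> differentiable (coord_map k \o phi) e_pt.
  move=> kp; rewrite E; apply: differentiable_comp; first exact: differentiable_right.
  apply: smooth_differentiable (@mul_loc_smooth i e_chart k) _.
  by apply: mul_dom_map => //; [exact: e_chartP|rewrite mulg1].
have cphi : {for e_pt, continuous phi}.
  have -> : phi = (fun z : Rn * Rn => coord_inv i z.1 * coord_inv e_chart z.2)%g
                  \o (fun u => (coord_map i p, u)).
    by apply/funext => u; rewrite /= coord_mapK.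
  apply: continuous_comp; first exact: differentiable_continuous (differentiable_right _ _).
  by apply: mul_inv_continuous; [exact: coord_map_range|exact: e_ptP].
have key := @curve_chart_change R n G Rn phi c i e_pt x cphi; rewrite phi1 in key.
apply: etrans (esym (key cp ip (dphi c cp))) _; rewrite E.
apply: derive_comp_affine => t; congr pair.
by rewrite /= scaler0 add0r.
Qed.

Lemma vf_loc_rvf x i p : cdomain i p ->
  vf_loc (rvf x) i (coord_map i p)
  = 'D_((x, 0) : Rn * Rn) (mul_loc e_chart i i) (e_pt, coord_map i p).
Proof.
move=> ip; rewrite (vf_locE _ ip) /rvf /tmap /rtrans /= mul1g.
rewrite -/e_chart -/e_pt.
set c := at_pt p.
pose phi : Rn -> G := fun u => (coord_inv e_chart u * p)%g.
have phi1 : phi e_pt = p by rewrite /phi coord_mapK ?mul1g //; exact: e_chartP.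
have cp : cdomain c p := at_ptP p.
have E (k : index) : coord_map k \o phi = mul_loc e_chart i k \o (fun u => (u, coord_map i p)).
  by apply/funext => u; rewrite /mul_loc /= coord_mapK.
have dphi (k : index) : cdomain k p -> differentiable (coord_map k \o phi) e_pt.
  move=> kp; rewrite E; apply: differentiable_comp; first exact: differentiable_left.
  apply: smooth_differentiable (@mul_loc_smooth e_chart i k) _.
  by apply: mul_dom_map => //; [exact: e_chartP|rewrite mul1g].
have cphi : {for e_pt, continuous phi}.
  have -> : phi = (fun z : Rn * Rn => coord_inv e_chart z.1 * coord_inv i z.2)%g
                  \o (fun u => (u, coord_map i p)).
    by apply/funext => u; rewrite /= coord_mapK.
  apply: continuous_comp; first exact: differentiable_continuous (differentiable_left _ _).
  by apply: mul_inv_continuous; [exact: e_ptP|exact: coord_map_range].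
have key := @curve_chart_change R n G Rn phi c i e_pt x cphi; rewrite phi1 in key.
apply: etrans (esym (key cp ip (dphi c cp))) _; rewrite E.
apply: derive_comp_affine => t; congr pair.
by rewrite /= scaler0 add0r.
Qed.


Lemma vf_loc_lvf_smooth x i : smooth_on (crange i) (vf_loc (lvf x) i).
Proof.
have aff (t : R) (q v : Rn) : (fun q : Rn => (q, e_pt)) (t *: v + q) =
    t *: (((v, 0)) : Rn * Rn) + (q, e_pt).
  by congr pair; rewrite /= scaler0 add0r.
have S := smooth_comp_affine (differentiable_left e_pt) aff
  (smooth_derive ((0, x) : Rn * Rn) (@mul_loc_smooth i e_chart i)).
have dom : crange i `<=` (fun q : Rn => (q, e_pt)) @^-1` mul_dom i e_chart i.
  move=> q iq /=; rewrite -(coord_invK iq).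
  by apply: mul_e_right; exact: coord_inv_domain.
apply: (smooth_eq (@crange_open R n G i) _ (smooth_sub dom S)) => q iq /=.
rewrite -[in RHS](coord_invK iq) vf_loc_lvf ?coord_invK //.
exact: coord_inv_domain.
Qed.

Lemma vf_loc_rvf_smooth x i : smooth_on (crange i) (vf_loc (rvf x) i).
Proof.
have aff (t : R) (q v : Rn) : (fun q : Rn => (e_pt, q)) (t *: v + q) =
    t *: (((0, v)) : Rn * Rn) + (e_pt, q).
  by congr pair; rewrite /= scaler0 add0r.
have S := smooth_comp_affine (differentiable_right e_pt) aff
  (smooth_derive ((x, 0) : Rn * Rn) (@mul_loc_smooth e_chart i i)).
have dom : crange i `<=` (fun q : Rn => (e_pt, q)) @^-1` mul_dom e_chart i i.
  move=> q iq /=; rewrite -(coord_invK iq).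
  by apply: mul_e_left; exact: coord_inv_domain.
apply: (smooth_eq (@crange_open R n G i) _ (smooth_sub dom S)) => q iq /=.
rewrite -[in RHS](coord_invK iq) vf_loc_rvf ?coord_invK //.
exact: coord_inv_domain.
Qed.

Lemma vf_loc_e (X : vfield G) : vf_loc X e_chart e_pt = X 1%g.
Proof. by rewrite (vf_locE X e_chartP) derive_transition_id //; exact: e_chartP. Qed.

Lemma lvf1 x : lvf (G := G) x 1%g = x.
Proof.
have mE : \forall u \near e_pt, (mul_loc e_chart e_chart e_chart \o (fun u => (e_pt, u))) u
    = transition e_chart e_chart u.
  by apply: filterE => u; rewrite /mul_loc /transition /= coord_mapK ?mul1g //; exact: e_chartP.
rewrite -[LHS]vf_loc_e vf_loc_lvf; last exact: e_chartP.
rewrite -[RHS](derive_transition_id x e_chartP) -(near_eq_derive x mE).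
symmetry; apply: derive_comp_affine => t; congr pair.
by rewrite /= scaler0 add0r.
Qed.

Lemma rvf1 x : rvf (G := G) x 1%g = x.
Proof.
have mE : \forall u \near e_pt, (mul_loc e_chart e_chart e_chart \o (fun u => (u, e_pt))) u
    = transition e_chart e_chart u.
  by apply: filterE => u; rewrite /mul_loc /transition /= coord_mapK ?mulg1 //; exact: e_chartP.
rewrite -[LHS]vf_loc_e vf_loc_rvf; last exact: e_chartP.
rewrite -[RHS](derive_transition_id x e_chartP) -(near_eq_derive x mE).
symmetry; apply: derive_comp_affine => t; congr pair.
by rewrite /= scaler0 add0r.
Qed.

(* Both sides are mixed second derivatives of the multiplication at the identity. *)
Lemma derive_rvf_lvf x y :
  'D_x (vf_loc (G := G) (rvf y) e_chart) e_pt =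
  'D_y (vf_loc (G := G) (lvf x) e_chart) e_pt.
Proof.
have nr : \forall q \near e_pt,
    ('D_((y, 0) : Rn * Rn) (mul_loc e_chart e_chart e_chart)
       \o (fun q => (e_pt, q))) q = vf_loc (rvf y) e_chart q.
  apply: (near_eq (@crange_open _ _ _ e_chart) e_ptP) => q iq /=.
  by rewrite -[in RHS](coord_invK iq) vf_loc_rvf ?coord_invK //; exact: coord_inv_domain.
have nl : \forall q \near e_pt,
    ('D_((0, x) : Rn * Rn) (mul_loc e_chart e_chart e_chart)
       \o (fun q => (q, e_pt))) q = vf_loc (lvf x) e_chart q.
  apply: (near_eq (@crange_open _ _ _ e_chart) e_ptP) => q iq /=.
  by rewrite -[in RHS](coord_invK iq) vf_loc_lvf ?coord_invK //; exact: coord_inv_domain.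
pose m := mul_loc e_chart e_chart e_chart.
have E1 : 'D_x ('D_((y, 0) : Rn * Rn) m \o (fun q => (e_pt, q))) e_pt
  = 'D_((0, x) : Rn * Rn) ('D_((y, 0) : Rn * Rn) m) (e_pt, e_pt).
  by apply: derive_comp_affine => t; congr pair; rewrite /= scaler0 add0r.
have E2 : 'D_y ('D_((0, x) : Rn * Rn) m \o (fun q => (q, e_pt))) e_pt
  = 'D_((y, 0) : Rn * Rn) ('D_((0, x) : Rn * Rn) m) (e_pt, e_pt).
  by apply: derive_comp_affine => t; congr pair; rewrite /= scaler0 add0r.
have E3 := derive_comm ((0, x) : Rn * Rn) ((y, 0) : Rn * Rn) (@finite_dim_rV R n)
  (@mul_dom_open e_chart e_chart e_chart) (mul_e_left e_chartP)
  (@mul_loc_smooth e_chart e_chart e_chart).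
apply: (etrans (esym (near_eq_derive x nr))).
apply: (etrans _ (near_eq_derive y nl)).
exact: (etrans E1 (etrans E3 (esym E2))).
Qed.

End Multiplication.

(** * Cyclic identities behind Jacobi and the 2-cocycle condition *)

Lemma cyclic_sum (R : comRingType) n (P : 'I_n -> 'I_n -> 'I_n -> R)
    (Q : 'I_n -> 'I_n -> R) (d : 'I_n -> 'I_n -> 'I_n -> R) :
  (forall i j k, P i j k - P j i k = \sum_(l < n) d i j l * Q l k) ->
  (forall i j k, P i j k - P i k j = \sum_(l < n) d j k l * Q i l) ->
  forall i j k,
    \sum_(l < n) (d i j l * (Q l k - Q k l) + d j k l * (Q l i - Q i l)
                  + d k i l * (Q l j - Q j l)) = 0.
Proof.
move=> P1 P2 i j k; under eq_bigr => l _ do rewrite !mulrBr.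
(* Each of the six sums is a difference of two values of P, and the twelve values cancel in
   pairs. *)
rewrite !big_split /= !sumrN -!P1 -!P2; ring.
Qed.

Section Cyclic.
Context {R : realType} {V : normedModType R}.
Hypothesis fV : finite_dim V.

(* The cyclic sums of A_i (A_j phi_k - A_k phi_j) and of [A_i, A_j] phi_k agree;
   [phi] = coordinates of left-invariant fields gives the Jacobi identity and
   [phi] = f gives the cocycle condition for alpha. *)
Lemma cyclic_identity n (U : set V) x (A : 'I_n -> V -> V) (phi : 'I_n -> V -> R)
    (d : 'I_n -> 'I_n -> 'I_n -> R) (a : 'I_n -> 'I_n -> R) :
  open U -> U x -> (forall i, smooth_on U (A i)) ->
  (forall i, smooth_on U (phi i)) ->
  (forall i j, 'D_(A i x) (A j) x - 'D_(A j x) (A i) x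
               = \sum_(l < n) d i j l *: A l x) ->
  (forall i j y, U y -> 'D_(A i y) (phi j) y - 'D_(A j y) (phi i) y
               = \sum_(l < n) d i j l * phi l y + a i j) ->
  forall i j k,
    \sum_(l < n) (d i j l * (\sum_(m < n) d l k m * phi m x + a l k)
                  + d j k l * (\sum_(m < n) d l i m * phi m x + a l i)
                  + d k i l * (\sum_(m < n) d l j m * phi m x + a l j)) = 0.
Proof.
move=> oU Ux sA sphi brA brphi i j k.
have dA i' := smooth_differentiable (sA i') Ux.
have dphi i' := smooth_differentiable (sphi i') Ux.
pose P i j k : R := 'D_(A i x) (fun y => 'D_(A j y) (phi k) y) x.
pose Q l k : R := 'D_(A l x) (phi k) x.
have P1 i' j' k' : P i' j' k' - P j' i' k' = \sum_(l < n) d i' j' l * Q l k'.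
  rewrite /P (bracket_derive fV oU Ux (sphi k') (dA i') (dA j')) brA.
  rewrite (derive_dir_sum _ _ (dphi k')); apply: eq_bigr => l _.
  exact: (derive_dirZ _ _ (dphi k')).
have P2 i' j' k' : P i' j' k' - P i' k' j' = \sum_(l < n) d j' k' l * Q i' l.
  have D1 := @diff_derivable _ _ _ _ _ (A i' x) (derive_along fV oU Ux (sphi k') (dA j')).1.
  have D2 := @diff_derivable _ _ _ _ _ (A i' x) (derive_along fV oU Ux (sphi j') (dA k')).1.
  rewrite /P -(deriveB D1 D2).
  (* The relation [brphi] holds on all of U, so it may be differentiated along [A i']; the constant
     a drops out. *)
  have nE : \forall y \near x,
      ((fun y => 'D_(A j' y) (phi k') y) - (fun y => 'D_(A k' y) (phi j') y)) y
      = (\sum_(l < n) (d j' k' l \*: phi l) + cst (a j' k')) y.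
    apply: (near_eq oU Ux) => y Uy.
    by apply: etrans (brphi j' k' y Uy) _; rewrite !fctE fct_sumE.
  rewrite (near_eq_derive (A i' x) nE).
  have dl l : derivable (d j' k' l \*: phi l) x (A i' x).
    by apply: derivableZ; exact: diff_derivable.
  rewrite deriveD; [|exact: derivable_sum|exact: derivable_cst].
  rewrite derive_cst addr0 derive_sum //.
  apply: eq_bigr => l _.
  exact: (deriveZ (d j' k' l) (@diff_derivable _ _ _ _ _ (A i' x) (dphi l))).
have Q1 l k' : \sum_(m < n) d l k' m * phi m x + a l k' = Q l k' - Q k' l.
  by rewrite -brphi.
under eq_bigr => l _ do rewrite !Q1.
exact: cyclic_sum P1 P2 i j k.
Qed.

(** Seen through psi, the bracket relation itself has the shape that [cyclic_identity] requires of
    phi, with a = 0; this is the origin of the [+ 0]. *)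
Lemma jacobi_fields n (U : set V) x (A : 'I_n -> V -> V)
    (d : 'I_n -> 'I_n -> 'I_n -> R) (psi : V -> R) :
  open U -> U x -> (forall i, smooth_on U (A i)) -> linear_diff psi ->
  (forall i j y, U y -> 'D_(A i y) (A j) y - 'D_(A j y) (A i) y
                        = \sum_(l < n) d i j l *: A l y) ->
  forall i j k,
    \sum_(l < n) (d i j l * (\sum_(m < n) d l k m * psi (A m x) + 0)
                  + d j k l * (\sum_(m < n) d l i m * psi (A m x) + 0)
                  + d k i l * (\sum_(m < n) d l j m * psi (A m x) + 0)) = 0.
Proof.
move=> oU Ux sA lpsi brA.
apply: (@cyclic_identity n U x A (fun i => psi \o A i) d (fun _ _ => 0)) => //.
- by move=> i; exact: smooth_linear_comp.
- by move=> i j; exact: brA.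
move=> i j y Uy; have dA k := smooth_differentiable (sA k) Uy.
rewrite (linear_diff_derive (A j y) lpsi (dA i)) (linear_diff_derive (A i y) lpsi (dA j)).
rewrite -(linear_diffB _ _ lpsi) (brA i j y Uy) (linear_diff_sum _ _ _ lpsi) addr0.
by [].
Qed.

End Cyclic.

(** * The bracket in an arbitrary chart *)

Section Brackets.
Context {R : realType} {n : nat} {G : lieGroupType R n}.
Local Notation Rn := 'rV[R]_n.
Local Notation index := (@chart_index R n G).
Implicit Types (i j k : index) (p : G) (q x y : Rn).

Lemma linear_rV_diff (c : {linear Rn -> R^o}) : linear_diff (c : Rn -> R).
Proof.
apply: continuous_linear_diff => x.
have -> : (c : Rn -> R) = \sum_(i < n) (fun v : Rn => v 0 i * c (delta_mx 0 i)).
  apply/funext => v; rewrite fct_sumE [in LHS](row_sum_delta v) linear_sum.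
  by apply: eq_bigr => i _; rewrite linearZ.
apply: differentiable_continuous; apply: differentiable_sum => i.
apply: (@differentiableM _ _ (fun v : Rn => v 0 i) (cst (c (delta_mx 0 i)))) => //.
exact: differentiable_coord.
Qed.

(* X (Y phi) does not depend on the chart in which it is computed, and its
   antisymmetrization determines the bracket as phi runs over coordinates. *)
Lemma bracket_loc (X Y : vfield G) i p : smooth_vf X -> smooth_vf Y -> cdomain i p ->
  let q := coord_map i p in
  'D_(vf_loc X i q) (vf_loc Y i) q - 'D_(vf_loc Y i q) (vf_loc X i) q
  = vf_loc (bracket X Y) i q.
Proof.
move=> sX sY ip q.
apply: finite_dim_inj (@finite_dim_rV R n) _ => psi lpsi.
have [dpsi Dpsi] := lpsi.
have iq : crange i q := coord_map_range ip.
pose phi : G -> R := psi \o coord_map i.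
pose c := at_pt p; have cp : cdomain c p := at_ptP p.
pose u := coord_map c p; have cu : crange c u := coord_map_range cp.
have ou : overlap c i u := overlap_map cp ip.
have sphi : smooth_on (overlap c i) (phi \o coord_inv c).
  exact: (smooth_linear_comp (@overlap_open _ _ _ c i) lpsi (@transition_smooth _ _ _ c i)).
have nphi y : crange i y -> \forall z \near y, psi z = (phi \o coord_inv i) z.
  move=> iy; apply: (near_eq (@crange_open _ _ _ i) iy) => z iz.
  by rewrite /phi /= coord_invK.
have dphi y : crange i y -> differentiable (phi \o coord_inv i) y.
  by move=> iy; apply: near_eq_differentiable (nphi y iy) _.
have Dphi y v : crange i y -> 'D_v (phi \o coord_inv i) y = psi v.
  by move=> iy; rewrite -(near_eq_derive v (nphi y iy)) Dpsi.
have locc (Z : vfield G) : vf_loc Z c u = Z p.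
  by rewrite (vf_locE Z cp) (derive_transition_id _ cp).
(* The left side is Z (W phi) in the preferred chart. In the chart i the function phi is the linear
   functional psi, so only the derivative of the components of W remains. *)
have iter (Z W : vfield G) : smooth_vf W ->
    'D_(Z p) (fun y => 'D_(vf_loc W c y) (phi \o coord_inv c) y) u
    = psi ('D_(vf_loc Z i q) (vf_loc W i) q).
  move=> sW; have dW := smooth_differentiable (sW i) iq.
  have n1 : \forall y \near u, (vf_app W phi \o coord_inv c) y
      = 'D_(vf_loc W c y) (phi \o coord_inv c) y.
    apply: (near_eq (@overlap_open _ _ _ c i) ou) => y oy; have [cy iy] := oy.
    have dy := smooth_differentiable sphi oy.
    have Ey := @vf_app_loc _ _ _ W phi c (coord_inv c y) (coord_inv_domain cy).
    by rewrite (coord_invK cy) in Ey; exact: Ey dy.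
  have n2 : \forall y \near q, (psi \o vf_loc W i) y = (vf_app W phi \o coord_inv i) y.
    apply: (near_eq (@crange_open _ _ _ i) iq) => y iy.
    have Ey := @vf_app_loc _ _ _ W phi i (coord_inv i y) (coord_inv_domain iy).
    rewrite (coord_invK iy) in Ey.
    exact: (etrans (esym (Dphi y _ iy)) (esym (Ey (dphi y iy)))).
  have d2 : differentiable (vf_app W phi \o coord_inv i) q.
    by apply: near_eq_differentiable n2 _; exact: differentiable_comp.
  rewrite -(near_eq_derive _ n1).
  have -> : 'D_(Z p) (vf_app W phi \o coord_inv c) u = vf_app Z (vf_app W phi) p by [].
  rewrite (vf_app_loc Z ip d2) -(near_eq_derive _ n2).
  by rewrite (derive_comp _ dW (dpsi _)) Dpsi.
have psiB v v' : psi (v - v') = psi v - psi v'.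
  by rewrite -(Dpsi 0) (derive_dirB _ _ (dpsi 0)) !Dpsi.
have H := bracket_derive (@finite_dim_rV R n) (@overlap_open _ _ _ c i) ou sphi
  (smooth_differentiable (sX c) cu) (smooth_differentiable (sY c) cu).
rewrite (locc X) (locc Y) in H.
apply: (etrans (psiB _ _)).
apply: (etrans (congr2 (fun a b => a - b) (esym (iter X Y sY)) (esym (iter Y X sX)))).
apply: (etrans H).
apply: (etrans _ (Dphi q _ iq)).
exact: (vf_app_loc (bracket X Y) ip (dphi q iq)).
Qed.

End Brackets.

(** * Structure constants: antisymmetry, right-invariant brackets, Jacobi identity *)

Section StructureConstants.
Context {R : realType} {n : nat} {G : lieGroupType R n}.
Local Notation Rn := 'rV[R]_n.
Variables (E : n.-tuple Rn) (C : 'I_n -> 'I_n -> 'I_n -> R).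
Hypotheses (hE : basis_of fullv E) (hC : structure_constants (G := G) E C).

Local Notation o := (e_pt (G := G)).
Local Notation c0 := (e_chart (G := G)).

Lemma wlin_diff i : linear_diff (wlin E i).
Proof. exact: (linear_rV_diff (coord E i)). Qed.

Lemma wlin_basis i j : wlin E i (tnth E j) = (i == j)%:R.
Proof.
by rewrite /wlin (tnth_nth 0) coord_free ?(basis_free hE) // eq_sym.
Qed.

Lemma wlin_expand x : x = \sum_(i < n) wlin E i x *: tnth E i.
Proof.
rewrite [LHS](coord_basis hE (memvf x)).
by apply: eq_bigr => i _; rewrite (tnth_nth 0).
Qed.

Lemma wlin_sum i (a : 'I_n -> R) : wlin E i (\sum_(j < n) a j *: tnth E j) = a i.
Proof.
rewrite /wlin linear_sum (bigD1 i) //= big1 ?addr0 => [|j ji].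
  by rewrite linearZ /= -/(wlin E i _) wlin_basis eqxx mulr1.
by rewrite linearZ /= -/(wlin E i _) wlin_basis eq_sym (negbTE ji) mulr0.
Qed.

Lemma Ehat1 i : Ehat E i (1%g : G) = tnth E i.
Proof. exact: lvf1. Qed.

Lemma Etilde1 i : Etilde E i (1%g : G) = tnth E i.
Proof. exact: rvf1. Qed.

Lemma lvf_bracket_e i j :
  'D_(tnth E i) (vf_loc (Ehat (G := G) E j) c0) o
  - 'D_(tnth E j) (vf_loc (Ehat (G := G) E i) c0) o
  = \sum_(k < n) C i j k *: tnth E k.
Proof.
have := hC i j 1%g; rewrite /bracket (Ehat1 i) (Ehat1 j).
by under eq_bigr do rewrite Ehat1.
Qed.

(** Read off at e, where the [Ehat k] form the basis E and coefficients can be compared. *)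
Lemma structure_anti i j k : C i j k = - C j i k.
Proof.
have B1 := lvf_bracket_e i j; have B2 := congr1 -%R (lvf_bracket_e j i).
have := congr1 (wlin E k) (etrans (esym B1) (etrans (esym (opprB _ _)) B2)).
by rewrite -sumrN; under [in RHS]eq_bigr do rewrite -scaleNr; rewrite !wlin_sum.
Qed.

(** [derive_rvf_lvf] replaces the derivative of tilde E_j along E_i by that of hat E_i along E_j;
    this exchange of indices is the source of the minus sign. *)
Lemma rvf_bracket_e i j :
  'D_(tnth E i) (vf_loc (Etilde (G := G) E j) c0) o
  - 'D_(tnth E j) (vf_loc (Etilde (G := G) E i) c0) o
  = \sum_(k < n) - C i j k *: tnth E k.
Proof.
have B := lvf_bracket_e j i.
apply: (etrans (congr2 (fun a b => a - b)
  (derive_rvf_lvf (G := G) (tnth E i) (tnth E j))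
  (derive_rvf_lvf (G := G) (tnth E j) (tnth E i)))).
apply: (etrans B); apply: eq_bigr => k _.
by rewrite structure_anti.
Qed.

(** The proof of the Jacobi identity differentiates the bracket relation, so it is needed in one
    chart on an open set, whereas [bracket] uses a different chart at each point. *)
Lemma lvf_bracket_loc i j q : crange c0 q ->
  'D_(vf_loc (Ehat E i) c0 q) (vf_loc (Ehat E j) c0) q
  - 'D_(vf_loc (Ehat E j) c0 q) (vf_loc (Ehat E i) c0) q
  = \sum_(k < n) C i j k *: vf_loc (Ehat E k) c0 q.
Proof.
move=> cq; set p := coord_inv c0 q.
have cp : cdomain c0 p := coord_inv_domain cq.
have sl k : smooth_vf (Ehat (G := G) E k) by move=> i'; exact: vf_loc_lvf_smooth.
have := bracket_loc (sl i) (sl j) cp; rewrite (coord_invK cq) => ->.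
rewrite -(coord_invK cq) -/p (vf_locE _ cp) hC.
have dt := transition_differentiable (at_ptP p) cp.
rewrite (derive_dir_sum _ _ dt); apply: eq_bigr => k _.
by rewrite (derive_dirZ _ _ dt) (vf_locE _ cp).
Qed.

Lemma jacobi i j k m :
  \sum_(l < n) (C i j l * C l k m + C j k l * C l i m + C k i l * C l j m) = 0.
Proof.
have sA i' := @vf_loc_lvf_smooth R n G (tnth E i') c0.
have := jacobi_fields (@finite_dim_rV R n) (@crange_open _ _ _ c0) e_ptP sA
  (wlin_diff m) lvf_bracket_loc i j k.
move=> J; apply: etrans J; apply: eq_bigr => l _.
(* At e the fields are the basis vectors, and [wlin E m] picks out the single constant. *)
have S l' k' : \sum_(m0 < n) C l' k' m0 * wlin E m (vf_loc (lvf (tnth E m0)) c0 o) + 0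
    = C l' k' m.
  rewrite addr0 (bigD1 m) //= big1 => [|m' mm].
    by rewrite vf_loc_e lvf1 wlin_basis eqxx mulr1 addr0.
  by rewrite vf_loc_e lvf1 wlin_basis eq_sym (negbTE mm) mulr0.
by rewrite !S.
Qed.

End StructureConstants.

(** * The cocycle conditions for alpha and b *)

Section Cocycles.
Context {R : realType} {n : nat} {G : lieGroupType R n}.
Local Notation Rn := 'rV[R]_n.
Variables (E : n.-tuple Rn) (C : 'I_n -> 'I_n -> 'I_n -> R).
Hypotheses (hE : basis_of fullv E) (hC : structure_constants (G := G) E C).

Local Notation o := (e_pt (G := G)).
Local Notation c0 := (e_chart (G := G)).

Lemma vf_app_e_chart (X : vfield G) (phi : G -> R) q : smooth_fun phi -> crange c0 q ->
  vf_app X phi (coord_inv c0 q) = 'D_(vf_loc X c0 q) (phi \o coord_inv c0) q.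
Proof.
move=> sphi cq; have Ey := @vf_app_loc _ _ _ X phi c0 _ (coord_inv_domain cq).
by rewrite (coord_invK cq) in Ey; exact: Ey (smooth_differentiable (sphi c0) cq).
Qed.

(** Antisymmetry moves the summed index to the first slot of the second factor; the cyclic sum is
    then minus the Jacobi identity contracted with theta. *)
Lemma cocycle2_coboundary (theta : 'I_n -> R) :
  cocycle2 C (fun i j => \sum_(k < n) C i j k * theta k).
Proof.
have CA := structure_anti hE hC.
split=> [i j|i j k].
  by rewrite -sumrN; apply: eq_bigr => k _; rewrite CA mulNr.
under eq_bigr => l _.
  rewrite !mulr_suml -!big_split /=; over.
rewrite exchange_big big1 // => m _ /=.
have J := jacobi hE hC j k i m.
transitivity (- theta m * \sum_(l < n)
    (C j k l * C l i m + C k i l * C l j m + C i j l * C l k m)).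
  rewrite mulr_sumr; apply: eq_bigr => l _.
  rewrite (CA i l m) (CA j l m) (CA k l m); ring.
by rewrite J mulr0.
Qed.

Lemma cocycle2_sub (a a' : 'I_n -> 'I_n -> R) :
  cocycle2 C a -> cocycle2 C a' -> cocycle2 C (fun i j => a i j - a' i j).
Proof.
move=> [a1 a2] [a1' a2']; split=> [i j|i j k].
  by rewrite a1 a1' opprB opprK addrC.
apply: (etrans _ (etrans (congr2 (fun x y => x - y) (a2 i j k) (a2' i j k)) (subrr 0))).
by rewrite -sumrB; apply: eq_bigr => l _; ring.
Qed.

(** With d = - C and a = alpha, [cyclic_identity] gives the cocycle identity for alpha - [beta],
    where [beta] is the coboundary of the values of f at e. The identity for [beta] is Jacobi, and
    adding it removes [beta]. *)
Lemma alpha_cocycle (f : 'I_n -> G -> R) (alpha : 'I_n -> 'I_n -> R) :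
  (forall i, smooth_fun (f i)) ->
  (forall i j p, alpha i j
        = vf_app (Etilde E i) (f j) p - vf_app (Etilde E j) (f i) p
          + \sum_(l < n) C i j l * f l p) ->
  cocycle2 C alpha.
Proof.
move=> sf ha; have CA := structure_anti hE hC.
have anti i j : alpha i j = - alpha j i.
  rewrite (ha i j 1%g) (ha j i 1%g) opprD opprB; congr (_ + _).
  by rewrite -sumrN; apply: eq_bigr => l _; rewrite CA mulNr.
split=> // i j k.
have sA i' : smooth_on (crange c0) (vf_loc (Etilde (G := G) E i') c0).
  exact: vf_loc_rvf_smooth.
pose phi i' := f i' \o coord_inv c0.
have brA i' j' : 'D_(vf_loc (Etilde (G := G) E i') c0 o) (vf_loc (Etilde E j') c0) o
   - 'D_(vf_loc (Etilde (G := G) E j') c0 o) (vf_loc (Etilde E i') c0) o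
   = \sum_(l < n) - C i' j' l *: vf_loc (Etilde (G := G) E l) c0 o.
  under [RHS]eq_bigr do rewrite vf_loc_e Etilde1.
  by rewrite !vf_loc_e !Etilde1; exact: rvf_bracket_e.
have brphi i' j' y : crange c0 y ->
    'D_(vf_loc (Etilde E i') c0 y) (phi j') y - 'D_(vf_loc (Etilde E j') c0 y) (phi i') y
    = \sum_(l < n) - C i' j' l * phi l y + alpha i' j'.
  move=> cy; rewrite (ha i' j' (coord_inv c0 y)).
  rewrite (vf_app_e_chart _ (sf i') cy) (vf_app_e_chart _ (sf j') cy).
  rewrite addrCA -big_split /= big1 ?addr0 // => l _.
  by rewrite mulNr; exact: addNr.
have := cyclic_identity (@finite_dim_rV R n) (@crange_open _ _ _ c0) e_ptP sA
  (fun i' => sf i' c0) brA brphi i j k.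
move=> K; pose beta l k := \sum_(m < n) C l k m * phi m o.
have [banti bcyc] := cocycle2_coboundary (fun m => phi m o).
have betaN l' k' : \sum_(m < n) - C l' k' m * phi m o = - beta l' k'.
  by rewrite -sumrN; apply: eq_bigr => m _; rewrite mulNr.
have K' : \sum_(l < n) (- C i j l * (- beta l k + alpha l k)
    + - C j k l * (- beta l i + alpha l i) + - C k i l * (- beta l j + alpha l j)) = 0.
  by apply: etrans K; apply: eq_bigr => l _; rewrite !betaN.
apply: (etrans _ (etrans (congr2 +%R K' (bcyc i j k)) (addr0 0))).
rewrite -big_split; apply: eq_bigr => l _ /=.
rewrite -/(beta i l) -/(beta j l) -/(beta k l).
rewrite (anti i l) (anti j l) (anti k l) [beta i l]banti [beta j l]banti [beta k l]banti.
rewrite -/(beta l i) -/(beta l j) -/(beta l k).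
by move: (beta _ _) (beta _ _) (beta _ _) => *; ring.
Qed.

Lemma b_cocycle (L : TG G -> R) (f : 'I_n -> G -> R) (b : 'I_n -> R) :
  smooth_tfun L ->
  (forall i v, tvf_app (clift (Etilde E i)) L v
        = \sum_(j < n) w E j v * vf_app (Ehat E j) (f i) v.1 + b i) ->
  cocycle1 C b.
Proof.
move=> sL hb i j.
pose H : G -> R := fun p => L (p, 0).
have HE c : H \o coord_inv c = (L \o tpoint c) \o (fun q => (q, 0)).
  by apply/funext => q; rewrite /H /tpoint /= derive0.
have sH : smooth_fun H.
  move=> c; rewrite HE.
  have aff (t : R) (q v : Rn) : (fun q : Rn => (q, 0 : Rn)) (t *: v + q) =
    t *: ((v, 0) : Rn * Rn) + (q, 0).
    by congr pair; rewrite /= scaler0 add0r.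
  exact: (smooth_comp_affine (differentiable_left 0) aff (sL c)).
(* At a zero vector all w^j vanish and the complete lift has no fibre part. *)
have bE i' p : vf_app (Etilde E i') H p = b i'.
  have := hb i' (p, 0); rewrite big1 => [|l _]; last first.
    by rewrite /w linear0 mul0r.
  rewrite add0r => <-; rewrite /tvf_app tcenterE /clift /= derive0 /vf_app HE.
  apply: derive_comp_affine => t; congr pair.
  by rewrite /= scaler0 add0r.
have sA i' : smooth_on (crange c0) (vf_loc (Etilde (G := G) E i') c0).
  exact: vf_loc_rvf_smooth.
have dA i' := smooth_differentiable (sA i') e_ptP.
have dH := smooth_differentiable (sH c0) e_ptP.
have nb i' v : 'D_v (fun y => 'D_(vf_loc (Etilde E i') c0 y) (H \o coord_inv c0) y) o = 0.
  rewrite -(derive_cst (b i') o v); apply: near_eq_derive.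
  apply: (near_eq (@crange_open _ _ _ c0) e_ptP) => y cy.
  by rewrite -(vf_app_e_chart _ sH cy) bE.
(* The zeros are derivatives of the constants b_j and b_i; the right side is the bracket of the two
   fields at e, applied to H. *)
have S : 0 - 0 = 'D_(\sum_(l < n) - C i j l *: tnth E l) (H \o coord_inv c0) o.
  apply: (etrans (congr2 (fun a b => a - b) (esym (nb j (vf_loc (Etilde E i) c0 o)))
    (esym (nb i (vf_loc (Etilde E j) c0 o))))).
  apply: (etrans (bracket_derive (@finite_dim_rV R n) (@crange_open _ _ _ c0) e_ptP
    (sH c0) (dA i) (dA j))).
  apply: (congr1 (fun v => 'D_v (H \o coord_inv c0) o)).
  by rewrite !vf_loc_e !Etilde1; exact: rvf_bracket_e.
have db l : 'D_(tnth E l) (H \o coord_inv c0) o = b l.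
  have := vf_app_e_chart (Etilde E l) sH e_ptP.
  by rewrite bE vf_loc_e Etilde1 => <-.
rewrite (derive_dir_sum _ _ dH) subr0 in S.
apply: (etrans _ (etrans (congr1 -%R (esym S)) (oppr0 _))).
rewrite -sumrN; apply: eq_bigr => l _.
by rewrite (derive_dirZ _ _ dH) db scaleNr opprK mulrC.
Qed.

End Cocycles.

(** * Derivatives along vertical and complete lifts in a product chart *)

Section Core.
Context {R : realType} {V : normedModType R}.
Hypothesis fV : finite_dim V.

Lemma derive_linear_diff (W : normedModType R) (A : V -> W) x : differentiable A x ->
  linear_diff (fun y => 'D_y A x).
Proof.
move=> dA; have -> : (fun y => 'D_y A x) = 'd A x by apply/funext => y; rewrite deriveE.
by apply: continuous_linear_diff; exact: diff_continuous.
Qed.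

Lemma derive_pair0l (W : normedModType R) (A : V -> W) (x v : V) :
  differentiable A x -> differentiable (fun y => (0 : W, A y)) x /\
  'D_v (fun y => (0 : W, A y)) x = (0, 'D_v A x).
Proof.
move=> dA; have dc := differentiable_cst (0 : W) x.
have dp := differentiable_pair dc dA; split => //.
by rewrite !deriveE // (diff_pair dc dA) diff_cst.
Qed.

(** The extra term comes from the dependence of A on the base point. Its direction is the fibre part
    of the complete lift of A, so it cancels against the other side of the Euler-Lagrange equation
    in [lagrangian_e]. *)
Lemma derive_vertical_field (U : set (V * V)) (F : V * V -> R) (A : V -> V) o x eta :
  open U -> U (o, x) -> smooth_on U F -> differentiable A o ->
  'D_((x, eta) : V * V) (fun z => 'D_((0, A z.1) : V * V) F z) (o, x)
  = 'D_((x, eta) : V * V) ('D_((0, A o) : V * V) F) (o, x)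
    + 'D_((0, 'D_x A o) : V * V) F (o, x).
Proof.
move=> oU Ux sF dA.
pose B := (fun y : V => (0 : V, A y)) \o (fst : V * V -> V).
have [dB1 DB1] := derive_pair0l x dA.
have [d1 D1] := linear_diff_fst V V.
have dB : differentiable B (o, x) by exact: differentiable_comp.
have [_ H] := derive_along (finite_dim_prod fV fV) oU Ux sF dB.
apply: (etrans (H (x, eta))).
apply: (congr1 (fun v => 'D_((x, eta) : V * V) ('D_((0, A o) : V * V) F) (o, x)
   + 'D_v F (o, x))).
by rewrite /B (derive_comp _ (d1 (o, x)) dB1) D1.
Qed.

(** Made for complete lifts on a single fibre: there the base part e is fixed and the fibre part T y
    is linear in y. *)
Lemma derive_affine_field (U : set (V * V)) (F : V * V -> R) (T : V -> V) o e x v :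
  open U -> U (o, x) -> smooth_on U F -> linear_diff T ->
  'D_v (fun y => 'D_((e, T y) : V * V) F (o, y)) x
  = 'D_((0, v) : V * V) ('D_((e, T x) : V * V) F) (o, x)
    + 'D_((0, T v) : V * V) F (o, x).
Proof.
move=> oU Ux sF [dT DT].
pose B := (fun y : V => (e, T y)) \o (snd : V * V -> V).
have [d2 D2] := linear_diff_snd V V.
have dB1 : differentiable (fun y : V => (e, T y)) x.
  by apply: differentiable_pair.
have DB1 : 'D_v (fun y : V => (e, T y)) x = (0, T v).
  have dc := differentiable_cst e x.
  by rewrite -(DT x) !deriveE // (diff_pair dc (dT x)) diff_cst.
have dB : differentiable B (o, x) by exact: differentiable_comp.
have [_ H] := derive_along (finite_dim_prod fV fV) oU Ux sF dB.
have E : 'D_v ((fun z => 'D_(B z) F z) \o (fun y => (o, y))) x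
  = 'D_((0, v) : V * V) (fun z => 'D_(B z) F z) (o, x).
  by apply: derive_comp_affine => t; congr pair; rewrite /= scaler0 add0r.
apply: (etrans E); apply: (etrans (H _)).
apply: (congr1 (fun u => 'D_((0, v) : V * V) ('D_((e, T x) : V * V) F) (o, x)
   + 'D_u F (o, x))).
by rewrite /B (derive_comp _ (d2 (o, x)) dB1) D2.
Qed.

End Core.

(** The bookkeeping of [reduced_identity]: r is w; u and v are the fibre derivatives of L along
    [rder i] of E_j and [rder j] of E_i; a and c are the derivatives of f_j along E_i and of f_i
    along E_j; s is the gamma term and t is b_i. *)
Lemma weighted_rearrange (R : comRingType) n (u v a c r : 'I_n -> R) (s t : R) :
  \sum_(j < n) r j * u j + (\sum_(j < n) r j * (a j - v j) + s)
    = \sum_(j < n) r j * c j + t ->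
  s - \sum_(j < n) r j * (v j - u j) = \sum_(j < n) (c j - a j) * r j + t.
Proof.
have E : \sum_(j < n) r j * u j + \sum_(j < n) r j * (a j - v j)
    + \sum_(j < n) r j * (v j - u j) + \sum_(j < n) (c j - a j) * r j
    = \sum_(j < n) r j * c j.
  by rewrite -!big_split; apply: eq_bigr => j _ /=; ring.
rewrite -{}E; set A := \sum_(j < n) r j * u j; set B := \sum_(j < n) r j * (a j - v j).
move: (\sum_(j < n) r j * (v j - u j)) (\sum_(j < n) (c j - a j) * r j) => D F H.
have -> : s = D + F + t by apply: (addrI (A + B)); rewrite -addrA H; ring.
ring.
Qed.

(** * The Euler-Lagrange equation on T_e G *)

Section AtIdentity.
Context {R : realType} {n : nat} {G : lieGroupType R n}.
Local Notation Rn := 'rV[R]_n.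
Variables (E : n.-tuple Rn) (C : 'I_n -> 'I_n -> 'I_n -> R).
Hypotheses (hE : basis_of fullv E) (hC : structure_constants (G := G) E C).
Variable (L : TG G -> R).
Hypothesis sL : smooth_tfun L.

Local Notation o := (e_pt (G := G)).
Local Notation c0 := (e_chart (G := G)).
Local Notation F := (L \o tpoint c0).

(* The fibre component at (e, x) of the complete lift of [Etilde i]. *)
Definition rder (i : 'I_n) (x : Rn) : Rn := 'D_x (vf_loc (Etilde (G := G) E i) c0) o.

Lemma trange_open : open (trange c0).
Proof.
rewrite openE => z cz; rewrite /interior.
by have := @cvg_fst Rn Rn (nbhs z.1) (nbhs z.2) _; apply; exact: near_crange.
Qed.

Lemma trange_e x : trange c0 (o, x).
Proof. exact: e_ptP. Qed.

Lemma Etilde_differentiable i : differentiable (vf_loc (Etilde (G := G) E i) c0) o.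
Proof. exact: smooth_differentiable (vf_loc_rvf_smooth _ _) e_ptP. Qed.

Lemma rder_linear i : linear_diff (rder i).
Proof. exact: derive_linear_diff (Etilde_differentiable i). Qed.

Lemma F_differentiable x : differentiable F (o, x).
Proof. exact: smooth_differentiable (sL c0) (trange_e x). Qed.

Lemma tpoint_e x : tpoint c0 (o, x) = ((1%g : G), x).
Proof. by rewrite (tpoint_map x e_chartP) (derive_transition_id x e_chartP). Qed.

Lemma clift_e (X : vfield G) x : tvf_app (clift X) L (1%g, x) =
  'D_((X 1%g, 'D_x (vf_loc X c0) o) : Rn * Rn) F (o, x).
Proof. by rewrite /tvf_app tcenterE. Qed.

Lemma vlift_near (X : vfield G) x : \forall z \near ((o, x) : Rn * Rn),
  (tvf_app (vlift X) L \o tpoint c0) z = 'D_((0, vf_loc X c0 z.1) : Rn * Rn) F z.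
Proof.
apply: (near_eq trange_open (trange_e x)) => -[q y] cq /=.
have := vlift_loc X L y (coord_inv_domain cq).
by rewrite (coord_invK cq).
Qed.

Lemma dw_e j x :
  dw E j (fun y => L (1%g, y)) x = 'D_((0, tnth E j) : Rn * Rn) F (o, x).
Proof.
have -> : (fun y => L (1%g, y)) = F \o (fun y => (o, y)).
  by apply/funext => y; rewrite /= tpoint_e.
by apply: derive_comp_affine => t; congr pair; rewrite /= scaler0 add0r.
Qed.

Lemma dw2_e i j x :
  dw E i (dw E j (fun y => L (1%g, y))) x =
  'D_((0, tnth E i) : Rn * Rn) ('D_((0, tnth E j) : Rn * Rn) F) (o, x).
Proof.
have -> : dw E j (fun y => L (1%g, y))
    = 'D_((0, tnth E j) : Rn * Rn) F \o (fun y => (o, y)).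
  by apply/funext => y; exact: dw_e.
by apply: derive_comp_affine => t; congr pair; rewrite /= scaler0 add0r.
Qed.

Lemma vlift_e (Psi : TG G -> R) i x :
  tvf_app (vlift (Ehat E i)) Psi (1%g, x) = dw E i (fun y => Psi (1%g, y)) x.
Proof.
have -> : (fun y => Psi (1%g, y)) = (Psi \o tpoint c0) \o (fun y => (o, y)).
  by apply/funext => y; rewrite /= tpoint_e.
have := vlift_loc (Ehat E i) Psi x e_chartP.
rewrite -/(e_pt (G := G)) tpoint_e vf_loc_e Ehat1 => ->.
symmetry; apply: derive_comp_affine => t; congr pair.
by rewrite /= scaler0 add0r.
Qed.

Lemma vlift2_e i j x :
  tvf_app (vlift (Ehat E i)) (tvf_app (vlift (Ehat E j)) L) (1%g, x)
  = dw E i (dw E j (fun y => L (1%g, y))) x.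
Proof.
rewrite vlift_e; congr (dw E i _ x).
by apply/funext => y; exact: vlift_e.
Qed.

Lemma lagrangian_e (Gam : tvfield G) eta i x : lagrangian_for Gam L ->
  Gam (1%g, x) = (x, eta) ->
  'D_((x, eta) : Rn * Rn) ('D_((0, tnth E i) : Rn * Rn) F) (o, x)
  = 'D_((tnth E i, 0) : Rn * Rn) F (o, x).
Proof.
move=> lag gE.
have sX : smooth_vf (Etilde (G := G) E i) by move=> k; exact: vf_loc_rvf_smooth.
have E0 : 'D_((x, eta) : Rn * Rn) (tvf_app (vlift (Etilde E i)) L \o tpoint c0) (o, x)
    = tvf_app (clift (Etilde E i)) L (1%g, x).
  by rewrite -(lag _ sX) /tvf_app tcenterE gE.
have E1 := near_eq_derive (x, eta) (vlift_near (Etilde E i) x).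
have E2 := derive_vertical_field (@finite_dim_rV R n) eta trange_open (trange_e x)
  (sL c0) (Etilde_differentiable i).
have E3 := etrans (esym E2) (etrans (esym E1) (etrans E0 (clift_e _ _))).
have Ao : vf_loc (Etilde E i) c0 o = tnth E i by rewrite vf_loc_e Etilde1.
rewrite Ao Etilde1 in E3.
have P : ((tnth E i, rder i x) : Rn * Rn) = (tnth E i, 0) + (0, rder i x).
  by congr pair; rewrite /= ?addr0 ?add0r.
apply: (addIr ('D_((0, rder i x) : Rn * Rn) F (o, x))); apply: (etrans E3).
apply: (etrans (congr1 (fun v => 'D_v F (o, x)) P)).
exact: derive_dirD (F_differentiable x).
Qed.

Lemma w_e i x : w E i ((1%g : G), x) = wlin E i x.
Proof.
rewrite /w /wlin /=; congr (coord _ i x).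
by apply: eq_from_tnth => j; rewrite tnth_mktuple Ehat1.
Qed.

(** [is_reduced] produces derivatives of hat E_i along x. Expanding x in the basis and applying
    [derive_rvf_lvf] turns them into [rder j (tnth E i)]; exchanging the sums reassembles
    [rder j x], the fibre part of the complete lift of tilde E_j. *)
Lemma gam_e (Gam : tvfield G) (gamma : 'I_n -> Rn -> R) x : is_reduced E Gam gamma ->
  Gam (1%g, x) = (x, \sum_(j < n) wlin E j x *: rder j x
                     + \sum_(m < n) gamma m x *: tnth E m).
Proof.
case=> Gc [_ GamE gE]; rewrite GamE.
rewrite [LHS]surjective_pairing; congr pair.
  rewrite (big_morph (fst : Rn * Rn -> Rn) (id1 := 0) (op1 := +%R)) //=.
  rewrite [RHS](wlin_expand hE); apply: eq_bigr => i _.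
  by rewrite w_e scaler0 addr0 Ehat1.
rewrite (big_morph (snd : Rn * Rn -> Rn) (id1 := 0) (op1 := +%R)) //=.
under eq_bigr => i _ do rewrite w_e -gE Ehat1.
rewrite big_split /= -/c0 -/o; apply: (congr1 (+%R^~ _)).
have De i : 'D_x (vf_loc (Ehat (G := G) E i) c0) o
    = \sum_(j < n) wlin E j x *: rder j (tnth E i).
  have dl : differentiable (vf_loc (Ehat (G := G) E i) c0) o.
    exact: smooth_differentiable (vf_loc_lvf_smooth _ _) e_ptP.
  have S := derive_dir_sum (index_enum 'I_n) (fun j => wlin E j x *: tnth E j) dl.
  rewrite -(wlin_expand hE) in S.
  apply: (etrans S); apply: eq_bigr => j _.
  apply: (etrans (derive_dirZ _ _ dl)).
  apply: (congr1 (fun v => wlin E j x *: v)).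
  exact: (esym (derive_rvf_lvf _ _)).
transitivity (\sum_(i < n) \sum_(j < n) wlin E i x *: (wlin E j x *: rder j (tnth E i))).
  apply: eq_bigr => i _; rewrite -scaler_sumr.
  exact: (congr1 (fun v => wlin E i x *: v) (De i)).
rewrite exchange_big; apply: eq_bigr => j _ /=.
have S := linear_diff_sum (index_enum 'I_n) (wlin E ^~ x) (tnth E) (rder_linear j).
rewrite -(wlin_expand hE) in S.
rewrite S scaler_sumr; apply: eq_bigr => i _.
by rewrite !scalerA mulrC.
Qed.

Variables (f : 'I_n -> G -> R) (b : 'I_n -> R).
Hypothesis sf : forall i, smooth_fun (f i).
Hypothesis hb : forall i v, tvf_app (clift (Etilde E i)) L v
        = \sum_(j < n) w E j v * vf_app (Ehat E j) (f i) v.1 + b i.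

Definition fder (i : 'I_n) (x : Rn) : R := 'D_x (f i \o coord_inv c0) o.

Lemma fder_linear i : linear_diff (fder i).
Proof. exact: derive_linear_diff (smooth_differentiable (sf i c0) e_ptP). Qed.

Lemma wlin_sum_linear (c : Rn -> R) x : linear_diff c ->
  c x = \sum_(j < n) wlin E j x * c (tnth E j).
Proof.
move=> lc; have S := linear_diff_sum (index_enum 'I_n) (wlin E ^~ x) (tnth E) lc.
by rewrite -(wlin_expand hE) in S.
Qed.

Lemma clift_affine i x :
  'D_((tnth E i, rder i x) : Rn * Rn) F (o, x) = fder i x + b i.
Proof.
have := hb i (1%g, x); rewrite clift_e Etilde1 => ->; congr (_ + _).
rewrite (wlin_sum_linear _ (fder_linear i)); apply: eq_bigr => j _.
rewrite w_e; congr (_ * _); rewrite /vf_app Ehat1.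
by [].
Qed.

(** On T_e G the derivative of F along (E_j, [rder j y]) is the affine function [fder j y + b j],
    whose derivative along E_i is constant. The subtracted term accounts for the direction moving
    with y. *)
Lemma clift_affine_derive i j x :
  'D_((tnth E j, rder j x) : Rn * Rn) ('D_((0, tnth E i) : Rn * Rn) F) (o, x)
  = fder j (tnth E i) - 'D_((0, rder j (tnth E i)) : Rn * Rn) F (o, x).
Proof.
have A := derive_affine_field (@finite_dim_rV R n) (tnth E j) (tnth E i) trange_open
  (trange_e x) (sL c0) (rder_linear j).
have S := derive_comm ((0, tnth E i) : Rn * Rn) ((tnth E j, rder j x) : Rn * Rn)
  (@finite_dim_scalar R) trange_open (trange_e x) (sL c0).
have [df Df] := fder_linear j.
have T : 'D_(tnth E i) (fun y => 'D_((tnth E j, rder j y) : Rn * Rn) F (o, y)) x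
    = fder j (tnth E i).
  have -> : (fun y => 'D_((tnth E j, rder j y) : Rn * Rn) F (o, y)) = fder j + cst (b j).
    by apply/funext => y; exact: clift_affine.
  rewrite deriveD; [|exact: diff_derivable|exact: derivable_cst].
  by rewrite derive_cst addr0 Df.
apply: (etrans (esym S)); apply: (addIr ('D_((0, rder j (tnth E i)) : Rn * Rn) F (o, x))).
by apply: (etrans (esym A)); rewrite T subrK.
Qed.

Lemma reduced_identity (Gam : tvfield G) (gamma : 'I_n -> Rn -> R) i x :
  lagrangian_for Gam L -> is_reduced E Gam gamma ->
  \sum_(m < n) gamma m x * dw E m (dw E i (fun y => L (1%g, y))) x
  - \sum_(m < n) \sum_(j < n) C m i j * wlin E m x * dw E j (fun y => L (1%g, y)) x
  = \sum_(j < n) (fder i (tnth E j) - fder j (tnth E i)) * wlin E j x + b i.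
Proof.
move=> lag red.
have dF := F_differentiable x.
have dDF := smooth_differentiable
  (smooth_derive ((0, tnth E i) : Rn * Rn) (sL c0)) (trange_e x).
pose V v : R := 'D_((0, v) : Rn * Rn) F (o, x).
have VD v v' : V (v - v') = V v - V v'.
  rewrite /V -(derive_dirB _ _ dF); apply: (congr1 (fun v => 'D_v F (o, x))).
  by congr pair; rewrite /= subr0.
have VS (a : 'I_n -> R) (A : 'I_n -> Rn) :
    V (\sum_(j < n) a j *: A j) = \sum_(j < n) a j * V (A j).
  have -> : V (\sum_(j < n) a j *: A j)
      = 'D_(\sum_(j < n) a j *: ((0, A j) : Rn * Rn)) F (o, x).
    apply: (congr1 (fun v => 'D_v F (o, x))).
    rewrite [RHS]surjective_pairing; congr pair.
      rewrite (big_morph (fst : Rn * Rn -> Rn) (id1 := 0) (op1 := +%R)) //=.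
      by rewrite big1 // => j _; rewrite scaler0.
    by rewrite (big_morph (snd : Rn * Rn -> Rn) (id1 := 0) (op1 := +%R)).
  rewrite (derive_dir_sum _ _ dF); apply: eq_bigr => j _.
  exact: (derive_dirZ _ _ dF).
have EM := lagrangian_e i lag (gam_e x red).
(* Gamma at (e, x) as a combination of complete lifts of tilde E_j and vertical vectors, so that
   [clift_affine_derive] applies to each of the former. *)
have P : ((x, \sum_(j < n) wlin E j x *: rder j x
      + \sum_(m < n) gamma m x *: tnth E m) : Rn * Rn)
   = \sum_(j < n) wlin E j x *: ((tnth E j, rder j x) : Rn * Rn)
     + \sum_(m < n) gamma m x *: ((0, tnth E m) : Rn * Rn).
  rewrite [RHS]surjective_pairing; congr pair => /=.
    rewrite !(big_morph (fst : Rn * Rn -> Rn) (id1 := 0) (op1 := +%R)) //=.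
    by rewrite [X in _ + X]big1 ?addr0 -?(wlin_expand hE) // => j _; rewrite scaler0.
  by rewrite !(big_morph (snd : Rn * Rn -> Rn) (id1 := 0) (op1 := +%R)).
rewrite P (derive_dirD _ _ dDF) !(derive_dir_sum _ _ dDF) in EM.
(* Trades the remaining base derivative of L for a fibre derivative and the data f_i, b_i. *)
have B : V (rder i x) + 'D_((tnth E i, 0) : Rn * Rn) F (o, x) = fder i x + b i.
  rewrite -clift_affine /V -(derive_dirD _ _ dF).
  by apply: (congr1 (fun v => 'D_v F (o, x))); congr pair; rewrite /= ?add0r ?addr0.
have EM1 : \sum_(j < n) wlin E j x * (fder j (tnth E i) - V (rder j (tnth E i)))
    + \sum_(m < n) gamma m x * dw E m (dw E i (fun y => L (1%g, y))) x
    = 'D_((tnth E i, 0) : Rn * Rn) F (o, x).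
  apply: (etrans _ EM); apply: congr2; apply: eq_bigr => j _.
    apply: (etrans _ (esym (derive_dirZ _ _ dDF))).
    exact: (congr1 (fun v => wlin E j x * v) (esym (clift_affine_derive i j x))).
  apply: (etrans _ (esym (derive_dirZ _ _ dDF))).
  exact: (congr1 (fun v => gamma j x * v) (dw2_e j i x)).
have Vr : V (rder i x) = \sum_(j < n) wlin E j x * V (rder i (tnth E j)).
  have S := linear_diff_sum (index_enum 'I_n) (wlin E ^~ x) (tnth E) (rder_linear i).
  rewrite -(wlin_expand hE) in S.
  by rewrite S; exact: VS.
(* The fibre derivatives of L along the second derivatives of the product occur only
   antisymmetrized, hence along a bracket of right-invariant fields. *)
have VC m : \sum_(j < n) C m i j * V (tnth E j)
    = V (rder m (tnth E i)) - V (rder i (tnth E m)).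
  rewrite -(VS (C m i)) -VD; apply: (congr1 V).
  have := congr1 -%R (rvf_bracket_e hE hC m i).
  rewrite opprB -sumrN => H; apply: (etrans _ (esym H)).
  by apply: eq_bigr => k _; rewrite scaleNr opprK.
rewrite Vr (wlin_sum_linear x (fder_linear i)) -EM1 in B.
have -> : \sum_(m < n) \sum_(j < n) C m i j * wlin E m x * dw E j (fun y => L (1%g, y)) x
    = \sum_(m < n) wlin E m x * (V (rder m (tnth E i)) - V (rder i (tnth E m))).
  apply: eq_bigr => m _; rewrite -VC mulr_sumr; apply: eq_bigr => j _.
  by rewrite dw_e -/(V _) mulrCA mulrA.
exact: weighted_rearrange B.
Qed.

End AtIdentity.

(** * The freedom in the choice of l, and the comparison of the classes *)

Lemma derive_zero_const (R : realType) (V : normedModType R) (u : V -> R) :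
  (forall x, differentiable u x) -> (forall x v, 'D_v u x = 0) ->
  forall x, u x = u 0.
Proof.
move=> du Du x; apply/eqP; rewrite -subr_eq0.
have [t _] := @mean_value_line R V u 0 x 1 ltr01 (fun t _ => du (0 + t *: x)).
by rewrite Du mulr0 scale1r add0r => ->.
Qed.

Lemma second_derivatives_gradient (R : realType) n (E : n.-tuple 'rV[R]_n)
    (l l' : 'rV[R]_n -> R) :
  basis_of fullv E -> smooth_on [set: 'rV[R]_n] l -> smooth_on [set: 'rV[R]_n] l' ->
  (forall i j x, dw E i (dw E j l) x = dw E i (dw E j l') x) ->
  exists a : 'I_n -> R, forall j x, dw E j l x = dw E j l' x + a j.
Proof.
move=> hE sl sl' H; exists (fun j => dw E j l 0 - dw E j l' 0) => j x.
have d1 y : differentiable (dw E j l) y.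
  exact: smooth_differentiable (smooth_derive _ sl) I.
have d2 y : differentiable (dw E j l') y.
  exact: smooth_differentiable (smooth_derive _ sl') I.
have D0 y v : 'D_v (dw E j l - dw E j l') y = 0.
  rewrite (deriveB (@diff_derivable _ _ _ _ _ v (d1 y)) (@diff_derivable _ _ _ _ _ v (d2 y))).
  have S1 := derive_dir_sum (index_enum 'I_n) (fun i => wlin E i v *: tnth E i) (d1 y).
  have S2 := derive_dir_sum (index_enum 'I_n) (fun i => wlin E i v *: tnth E i) (d2 y).
  rewrite -(wlin_expand hE) in S1; rewrite -(wlin_expand hE) in S2.
  rewrite S1 S2 -sumrB big1 // => i _.
  apply/eqP; rewrite subr_eq0; apply/eqP.
  apply: (etrans (derive_dirZ _ _ (d1 y))); apply: (etrans _ (esym (derive_dirZ _ _ (d2 y)))).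
  exact: (congr1 (fun z => wlin E i v * z) (H i j y)).
have /eqP := @derive_zero_const R _ _ (fun y => differentiableB (d1 y) (d2 y)) D0 x.
rewrite -[X in X == _]/(dw E j l x - dw E j l' x).
rewrite -[X in _ == X]/(dw E j l 0 - dw E j l' 0).
by rewrite subr_eq addrC => /eqP.
Qed.

Theorem mainTheorem5 (R : realType) (n : nat) (G : lieGroupType R n)
  (hG : connected [set: G])
  (E : n.-tuple 'rV[R]_n) (hE : basis_of fullv E)
  (C : 'I_n -> 'I_n -> 'I_n -> R) (hC : structure_constants (G := G) E C)
  (Gam : tvfield G) (hGam : is_sode Gam) (hinv : left_invariant_tvf Gam)
  (gamma : 'I_n -> 'rV[R]_n -> R) (hgamma : is_reduced E Gam gamma)
  (g : tensor2 G) (hg : invariant_multiplier E Gam g)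
  (L : TG G -> R) (f : 'I_n -> G -> R)
  (b : 'I_n -> R) (alpha : 'I_n -> 'I_n -> R)
  (hTG : determined_on_TG E C Gam g L f b alpha)
  (l : 'rV[R]_n -> R) (nu : 'I_n -> R) (mu : 'I_n -> 'I_n -> R)
  (hg0 : determined_on_g E C gamma (restricted_multiplier E g) l nu mu) :
  [/\ same_class1 C b nu,
      same_class2 C alpha mu,
      forall i, b i = nu i
    & (forall x, l x = L (1%g, x)) ->
      forall i j, alpha i j = mu i j + \sum_(k < n) C i j k * f k 1%g].
Proof.
case: hTG => [[[sL _] lag] gL sf hb ha].
case: hg0 => [sl hk muN hl].
pose Le x := L (1%g, x).
have sLe : smooth_on [set: 'rV[R]_n] Le.
  have aff (t : R) (y v : 'rV[R]_n) : (fun y => (e_pt (G := G), y)) (t *: v + y) =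
      t *: ((0, v) : 'rV[R]_n * 'rV[R]_n) + (e_pt (G := G), y).
    by congr pair; rewrite /= scaler0 add0r.
  have := smooth_comp_affine (differentiable_right _) aff (sL (@e_chart R n G)).
  move=> /(smooth_sub (U' := setT)) S.
  apply: (smooth_eq openT _ (S _)) => [y _|y _]; last exact: e_ptP.
  by rewrite /= tpoint_e.
(* Both sides are g(hat E_i, hat E_j) on T_e G. *)
have k2 i j x : dw E i (dw E j l) x = dw E i (dw E j Le) x.
  by rewrite hk -vlift2_e -gL.
have [a la] := second_derivatives_gradient hE sl sLe k2.
have RI i x := reduced_identity hE hC sL sf hb i x lag hgamma.
have alphaE i j : fder f j (tnth E i) - fder f i (tnth E j)
    = alpha i j - \sum_(k < n) C i j k * f k 1%g.
  rewrite (ha i j 1%g) addrK /vf_app !Etilde1.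
  by [].
(* Both sides are affine in x: x = 0 will give the constant terms, x = E_i the linear
   coefficients. *)
have key i x : \sum_(j < n) (alpha j i - \sum_(k < n) C j i k * f k 1%g) * wlin E j x + b i
    - \sum_(m < n) \sum_(j < n) C m i j * wlin E m x * a j
    = \sum_(j < n) mu j i * wlin E j x + nu i.
  rewrite -hl.
  under [X in X + _ - _]eq_bigr => j _ do rewrite -alphaE.
  rewrite -RI.
  have E1 : \sum_(m < n) gamma m x * dw E m (dw E i Le) x
      = \sum_(m < n) gamma m x * dw E m (dw E i l) x.
    by apply: eq_bigr => m _; rewrite k2.
  have E2 : \sum_(m < n) \sum_(j < n) C m i j * wlin E m x * dw E j Le x
      + \sum_(m < n) \sum_(j < n) C m i j * wlin E m x * a j
      = \sum_(m < n) \sum_(j < n) C m i j * wlin E m x * dw E j l x.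
    rewrite -big_split; apply: eq_bigr => m _; rewrite -big_split; apply: eq_bigr => j _.
    by rewrite la mulrDr.
  apply: (etrans _ (congr2 (fun y z => y - z) E1 E2)).
  by rewrite opprD addrA.
have bnu i : b i = nu i.
  have w0 j : wlin E j 0 = 0 by rewrite /wlin linear0.
  have := key i 0.
  rewrite [X in X + _ - _]big1 => [|j _]; last by rewrite w0 mulr0.
  rewrite [X in _ - X]big1 => [|m _]; last by rewrite big1 // => j _; rewrite w0 mulr0 mul0r.
  by rewrite big1 ?add0r ?subr0 // => j _; rewrite w0 mulr0.
have delta (c : 'I_n -> R) k : \sum_(j < n) c j * wlin E j (tnth E k) = c k.
  rewrite (bigD1 k) //= wlin_basis // eqxx mulr1 big1 ?addr0 // => j jk.
  by rewrite wlin_basis // (negbTE jk) mulr0.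
have amu i j : alpha i j = mu i j + \sum_(k < n) C i j k * (f k 1%g + a k).
  have := key j (tnth E i); rewrite !delta.
  have -> : \sum_(m < n) \sum_(k < n) C m j k * wlin E m (tnth E i) * a k
      = \sum_(k < n) C i j k * a k.
    rewrite -[RHS](delta (fun m => \sum_(k < n) C m j k * a k)); apply: eq_bigr => m _.
    by rewrite mulr_suml; apply: eq_bigr => k _; rewrite mulrAC.
  rewrite bnu => H; under eq_bigr => k _ do rewrite mulrDr.
  rewrite big_split /=; move: H.
  move: (\sum_(k < n) C i j k * f k 1%g) (\sum_(k < n) C i j k * a k) => s1 s2 H.
  have -> : mu i j = alpha i j - s1 - s2 by apply: (addIr (nu j)); rewrite -H; ring.
  ring.
have ca : cocycle2 C alpha := alpha_cocycle hE hC sf ha.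
have cb : cocycle1 C b := b_cocycle hE hC sL hb.
split=> //.
- split=> // [|i]; last by rewrite bnu subrr.
  by move=> i j; rewrite -[RHS](cb i j); apply: eq_bigr => k _; rewrite bnu.
- split=> //; last first.
    exists (fun k => f k 1%g + a k) => i j; rewrite amu addrC addKr.
    by apply: eq_bigr => k _; rewrite mulrC.
  (* [determined_on_g] only provides the antisymmetry of mu; the cocycle identity is inherited from
     alpha minus a coboundary. *)
  have [m1 m2] := cocycle2_sub ca (cocycle2_coboundary hE hC (fun k => f k 1%g + a k)).
  have muE i j : mu i j = alpha i j - \sum_(k < n) C i j k * (f k 1%g + a k).
    by rewrite amu addrK.
  split=> // i j k; rewrite -[RHS](m2 i j k); apply: eq_bigr => m _.
  by rewrite !muE.
move=> lL i j; rewrite amu; congr (_ + _); apply: eq_bigr => k _.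
(* For l equal to the restriction of L the two gradients coincide, so their constant difference a
   vanishes. *)
have -> : a k = 0; last by rewrite addr0.
have lLe : l = Le by apply/funext.
by have := la k 0; rewrite lLe -[LHS]addr0 => /addrI.
Qed.
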